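(* Fix $\alpha\in[0,\infty]$ with $\alpha\neq1$. The interpretation $\llbracket-\rrbracket$ induces an isomorphism of symmetric monoidal categories between $\mathrm{Syn}(\mathcal{T}_{\mathrm{R}\oplus,\alpha})$ and $\mathsf{FStoch}^\oplus$ which is locally an isometry with respect to $\mathrm{R}^{\max}_\alpha$: for all $n,m$, $[f]\mapsto\llbracket f\rrbracket$ is a well-defined bijection from $\mathrm{Syn}(\mathcal{T}_{\mathrm{R}\oplus,\alpha})(n,m)$ onto all $m\times n$ stochastic matrices, and $d^{\alpha}(f,g)=\mathrm{R}^{\max}_\alpha(\llbracket f\rrbracket,\llbracket g\rrbracket)$ for all terms $f,g:n\to m$.
   Context: $\mathsf{FStoch}^\oplus$ is the symmetric monoidal category whose objects are natural numbers, whose morphisms $n\to m$ are $m\times n$ column-stochastic matrices (for $n=0$ or $m=0$ the empty matrix where it exists), with matrix-multiplication composition and monoidal product the direct sum $A\oplus B=\begin{pmatrix}A&0\\0&B\end{pmatrix}$. Rényi divergence: for distributions $\mu,\nu$ on a finite set $X$ and $0<\alpha<\infty$, $\alpha\neq1$, $\mathrm{R}_\alpha(\mu,\nu)=\frac{1}{\alpha-1}\log\big(\sum_{x}\frac{\mu(x)^\alpha}{\nu(x)^{\alpha-1}}\big)$, where $\frac{x}{0}$ is $0$ if $x=0$ and $\infty$ otherwise, and $\log\infty=\infty$; $\mathrm{R}_0(\mu,\nu)=-\log\sum_{x:\mu(x)>0}\nu(x)$; $\mathrm{R}_\infty(\mu,\nu)=\sup_x\log\frac{\mu(x)}{\nu(x)}$.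 For $m\times n$ stochastic matrices, $\mathrm{R}^{\max}_\alpha(A,B)=\max_i\mathrm{R}_\alpha(A_i,B_i)$ over columns (and $0$ if $n$ or $m$ is $0$). Define $C_\alpha:[0,1]^2\times[0,\infty]^2\to[0,\infty]$ by $C_\alpha(p,q,\varepsilon,\delta)=\frac{1}{\alpha-1}\log\big(\frac{p^\alpha}{q^{\alpha-1}}e^{(\alpha-1)\varepsilon}+\frac{(1-p)^\alpha}{(1-q)^{\alpha-1}}e^{(\alpha-1)\delta}\big)$ for $0\le\alpha<\infty$, and $C_\infty(p,q,\varepsilon,\delta)=\max\{\log\frac pq+\varepsilon,\log\frac{1-p}{1-q}+\delta\}$. $\Sigma_{\mathrm{CA}}$ is the monoidal signature with one sort and generators $\eta:0\to1$, $\mu:2\to1$ and $c_p:1\to2$ for each $p\in[0,1]$; terms are built from generators, identities, symmetries, $;$ and $\otimes$, modulo the laws of symmetric strict monoidal categories. $\llbracket-\rrbracket$ is the symmetric monoidal functor into $\mathsf{FStoch}^\oplus$ (sending $\otimes$ to $\oplus$) with $\llbracket\eta\rrbracket$ the empty $1\times0$ matrix, $\llbracket\mu\rrbracket=(1\ 1)$ and $\llbracket c_p\rrbracket=\begin{pmatrix}p\\1-p\end{pmatrix}$. $\mathcal{T}_{\mathrm{CA}}$ is the monoidal theory of convex algebras of Fritz: a fixed set of equations such that (known result) two terms are equal modulo the congruence generated by these equations and the monoidal laws iff they have the same interpretation, and every morphism of $\mathsf{FStoch}^\oplus$ is the interpretation of a term. The theory $\mathcal{T}_{\mathrm{R}\oplus,\alpha}$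 over $\Sigma_{\mathrm{CA}}$ has as axioms: every equation of $\mathcal{T}_{\mathrm{CA}}$ (no premises); $f=_0f$ for every term; (Chain$_\oplus$) for all $f,g:1\to n$, $f',g':1\to m$, $p,q\in[0,1]$, $\varepsilon,\delta\in[0,\infty]$: from $f=_\varepsilon g$ and $f'=_\delta g'$ infer $c_p;(f\otimes f')=_{C_\alpha(p,q,\varepsilon,\delta)}c_q;(g\otimes g')$; (Parmax) for all $f,g:n\to m$, $f',g':n'\to m'$: from $f=_\varepsilon g$ and $f'=_\delta g'$ infer $f\otimes f'=_{\max\{\varepsilon,\delta\}}g\otimes g'$. Derivability ($\vdash$) means existence of a well-founded (possibly infinitely branching) proof tree with no open leaves using: the axioms; reflexivity, symmetry, transitivity of $=$ and its congruence with $;$ and $\otimes$; the monoidal laws as equations; replacement of a term by an equal one in either side of $f=_\varepsilon g$; monotonicity (from $f=_\varepsilon g$ infer $f=_{\varepsilon'}g$ for $\varepsilon\le\varepsilon'$); continuity (from $f=_{\varepsilon_i}g$ for all $i$ infer $f=_{\inf_i\varepsilon_i}g$); nonexpansiveness (from $f=_\varepsilon f'$, $g=_\delta g'$ infer $f;g=_{\varepsilon+\delta}f';g'$ and $f\otimes g=_{\varepsilon+\delta}f'\otimes g'$). $\mathrm{Syn}(\mathcal{T}_{\mathrm{R}\oplus,\alpha})$ has hom-sets of terms modulo $f\equiv g\iff\ \vdash f=g$, with distance $d^{\alpha}(f,g)=\inf\{\varepsilon\mid\ \vdash f=_\varepsilon g\}$. *)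

(* Defs.v *)
From HB Require Import structures.
From mathcomp Require Import all_boot all_order all_algebra.
From mathcomp Require Import generic_quotient.
From mathcomp Require Import zify.
From mathcomp Require Import boolp classical_sets reals constructive_ereal ereal.
From mathcomp Require Import interval_inference exp.

Set Implicit Arguments.
Unset Strict Implicit.
Unset Printing Implicit Defensive.

Import Order.TTheory GRing.Theory Num.Theory.

Local Open Scope quotient_scope.
Local Open Scope classical_set_scope.
Local Open Scope ring_scope.

(** * Strict symmetric monoidal categories with objects (nat, +, 0)

    Strict associativity and right unitality relate morphisms whose (co)domains
    are only propositionally equal; [hcast] transports along these equations. *)

Definition hcast (H : nat -> nat -> Type) n m n' m' (en : n = n') (em : m = m') :
    H n m -> H n' m' :=
  match en in _ = a, em in _ = b return H n m -> H a b with
  | erefl, erefl => fun f => f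
  end.

(* Composition is in diagrammatic order. *)
Record smc_ops := SmcOps {
  smc_hom : nat -> nat -> Type;
  smc_id : forall n, smc_hom n n;
  smc_comp : forall n m k, smc_hom n m -> smc_hom m k -> smc_hom n k;
  smc_tens : forall n m n' m',
    smc_hom n m -> smc_hom n' m' -> smc_hom (n + n')%N (m + m')%N;
  smc_symm : forall n m, smc_hom (n + m)%N (m + n)%N }.

Arguments smc_comp {s n m k}.
Arguments smc_tens {s n m n' m'}.
Arguments smc_symm {s}.
Arguments smc_id {s}.

Declare Scope smc_scope.
Delimit Scope smc_scope with smc.
Notation "f ;; g" := (smc_comp f g) (at level 50, left associativity) : smc_scope.
Notation "f [x] g" := (smc_tens f g) (at level 40, left associativity) : smc_scope.
Local Open Scope smc_scope.

Inductive ssmc_law (C : smc_ops) :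
    forall n m, smc_hom C n m -> smc_hom C n m -> Prop :=
| law_compA n m k l (f : smc_hom C n m) (g : smc_hom C m k) (h : smc_hom C k l) :
    ssmc_law (f ;; (g ;; h)) ((f ;; g) ;; h)
| law_idl n m (f : smc_hom C n m) : ssmc_law (smc_id n ;; f) f
| law_idr n m (f : smc_hom C n m) : ssmc_law (f ;; smc_id m) f
| law_tens_id n m : ssmc_law (smc_id n [x] smc_id m) (smc_id (n + m)%N)
| law_interchange n m k n' m' k' (f : smc_hom C n m) (g : smc_hom C m k)
    (f' : smc_hom C n' m') (g' : smc_hom C m' k') :
    ssmc_law ((f [x] f') ;; (g [x] g')) ((f ;; g) [x] (f' ;; g'))
| law_tensA n m n' m' n'' m'' (f : smc_hom C n m) (g : smc_hom C n' m')
    (h : smc_hom C n'' m'') :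
    ssmc_law (hcast (addnA n n' n'') (addnA m m' m'') (f [x] (g [x] h)))
             ((f [x] g) [x] h)
| law_tens0l n m (f : smc_hom C n m) : ssmc_law (smc_id 0 [x] f) f
| law_tens0r n m (f : smc_hom C n m) :
    ssmc_law (hcast (addn0 n) (addn0 m) (f [x] smc_id 0)) f
| law_symm_nat n m n' m' (f : smc_hom C n m) (g : smc_hom C n' m') :
    ssmc_law ((f [x] g) ;; smc_symm m m') (smc_symm n n' ;; (g [x] f))
| law_symmK n m : ssmc_law (smc_symm n m ;; smc_symm m n) (smc_id (n + m)%N)
| law_symm0 n : ssmc_law (hcast (addn0 n) erefl (smc_symm n 0)) (smc_id n)
| law_hexagon n m k :
    ssmc_law (smc_symm n (m + k)%N)
      (hcast (esym (addnA n m k)) (addnA m k n)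
         ((smc_symm n m [x] smc_id k) ;;
          hcast (addnA m n k) erefl (smc_id m [x] smc_symm n k))).

Record ssmc := Ssmc {
  ssmc_car :> smc_ops;
  ssmcP : forall n m (f g : smc_hom ssmc_car n m), ssmc_law f g -> f = g }.

(* Identity-on-objects isomorphisms of symmetric monoidal categories. *)
Record ssmc_iso (C D : ssmc)
    (F : forall n m, smc_hom C n m -> smc_hom D n m) : Prop :=
  SsmcIso {
    iso_id : forall n, F n n (smc_id n) = smc_id n;
    iso_comp : forall n m k (f : smc_hom C n m) (g : smc_hom C m k),
      F n k (f ;; g) = F n m f ;; F m k g;
    iso_tens : forall n m n' m' (f : smc_hom C n m) (g : smc_hom C n' m'),
      F _ _ (f [x] g) = F n m f [x] F n' m' g;
    iso_symm : forall n m, F _ _ (smc_symm n m) = smc_symm n m;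
    iso_bij : forall n m, bijective (F n m) }.

(** * Stochastic matrices *)

Section FStoch.
Variable R : realType.

Definition column_stochastic m n (A : 'M[R]_(m, n)) :=
  [forall j, (\sum_i A i j == 1) && [forall i, 0 <= A i j]].

Lemma column_stochasticP m n (A : 'M[R]_(m, n)) :
  reflect ((forall j, \sum_i A i j = 1) /\ (forall i j, 0 <= A i j))
          (column_stochastic A).
Proof.
apply: (iffP forallP) => [h|[h1 h2] j].
  by split=> [j|i j]; have /andP[/eqP ? /forallP ?] := h j.
by rewrite h1 eqxx; apply/forallP => i.
Qed.

(* The morphisms n -> m. *)
Record stoch (n m : nat) := Stoch {
  stoch_mx :> 'M[R]_(m, n);
  stochP : column_stochastic stoch_mx }.

HB.instance Definition _ n m := [isSub for @stoch_mx n m].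

Lemma stoch_id_subproof n : column_stochastic (1%:M : 'M[R]_n).
Proof.
apply/column_stochasticP; split=> [j|i j]; last by rewrite !mxE ler0n.
rewrite (bigD1 j)//= !mxE eqxx big1 ?addr0// => i ij.
by rewrite !mxE (negbTE ij).
Qed.

Lemma stoch_comp_subproof n m k (A : stoch n m) (B : stoch m k) :
  column_stochastic (stoch_mx B *m stoch_mx A).
Proof.
have /column_stochasticP[A1 A0] := stochP A.
have /column_stochasticP[B1 B0] := stochP B.
apply/column_stochasticP; split=> [j|i j]; last first.
  by rewrite !mxE sumr_ge0// => l _; rewrite mulr_ge0.
rewrite (eq_bigr (fun i => \sum_l B i l * A l j)); last by move=> i _; rewrite mxE.
rewrite exchange_big/= -[RHS](A1 j).
by apply: eq_bigr => l _; rewrite -mulr_suml B1 mul1r.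
Qed.

Lemma stoch_tens_subproof n m n' m' (A : stoch n m) (B : stoch n' m') :
  column_stochastic (block_mx (stoch_mx A) 0 0 (stoch_mx B)).
Proof.
have /column_stochasticP[A1 A0] := stochP A.
have /column_stochasticP[B1 B0] := stochP B.
apply/column_stochasticP; split=> [j|i j]; last first.
  rewrite !mxE; case: splitP => i' _; rewrite !mxE; case: splitP => j' _;
  by rewrite ?mxE.
rewrite big_split_ord/=; case: (split_ordP j) => j' ->.
  rewrite [X in _ + X]big1 => [|i _]; last by rewrite block_mxEdl mxE.
  by rewrite addr0 -[RHS](A1 j'); apply: eq_bigr => i _; rewrite block_mxEul.
rewrite [X in X + _]big1 => [|i _]; last by rewrite block_mxEur mxE.
by rewrite add0r -[RHS](B1 j'); apply: eq_bigr => i _; rewrite block_mxEdr.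
Qed.

Lemma stoch_symm_subproof n m :
  column_stochastic (block_mx 0 1%:M 1%:M 0 : 'M[R]_(m + n, n + m)).
Proof.
have /column_stochasticP[n1 n0] := stoch_id_subproof n.
have /column_stochasticP[m1 m0] := stoch_id_subproof m.
apply/column_stochasticP; split=> [j|i j]; last first.
  rewrite !mxE; case: splitP => i' _; rewrite !mxE; case: splitP => j' _;
  by rewrite !mxE ?ler0n.
rewrite big_split_ord/=; case: (split_ordP j) => j' ->.
  rewrite [X in X + _]big1 => [|i _]; last by rewrite block_mxEul mxE.
  by rewrite add0r -[RHS](n1 j'); apply: eq_bigr => i _; rewrite block_mxEdl.
rewrite [X in _ + X]big1 => [|i _]; last by rewrite block_mxEdr mxE.
by rewrite addr0 -[RHS](m1 j'); apply: eq_bigr => i _; rewrite block_mxEur.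
Qed.

Definition fstoch_ops : smc_ops := @SmcOps stoch
  (fun n => Stoch (stoch_id_subproof n))
  (fun n m k A B => Stoch (stoch_comp_subproof A B))
  (fun n m n' m' A B => Stoch (stoch_tens_subproof A B))
  (fun n m => Stoch (stoch_symm_subproof n m)).

Lemma hcast_stochE n m n' m' (en : n = n') (em : m = m') (A : stoch n m) :
  stoch_mx (hcast en em A) = castmx (em, en) (stoch_mx A).
Proof. by case: n' / en; case: m' / em. Qed.

(* [A] is the 0-1 matrix of the function [phi] on indices. *)
Let is_fmx m n (A : 'M[R]_(m, n)) (phi : nat -> nat) :=
  forall i j, A i j = (i == phi j :> nat)%:R.

Let fmx_mul n m k (A : 'M[R]_(m, n)) (B : 'M[R]_(k, m)) phi psi :
  (forall j, (j < n -> phi j < m)%N) ->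
  is_fmx A phi -> is_fmx B psi -> is_fmx (B *m A) (psi \o phi).
Proof.
move=> phim hA hB i j; rewrite mxE.
have lt := phim _ (ltn_ord j).
rewrite (bigD1 (Ordinal lt))//= big1 => [|l ne].
  by rewrite addr0 hA hB/= eqxx mulr1.
by rewrite hA -(inj_eq val_inj)/= in ne *; rewrite (negbTE ne) mulr0.
Qed.

Let fmx_1 n : is_fmx (1%:M : 'M[R]_n) id.
Proof. by move=> i j; rewrite mxE. Qed.

Let fmx_symm n m : is_fmx (block_mx 0 1%:M 1%:M 0 : 'M[R]_(m + n, n + m))
  (fun j => if (j < n)%N then (m + j)%N else (j - n)%N).
Proof.
move=> i j; case: (split_ordP j) => j' ->; case: (split_ordP i) => i' ->;
rewrite ?block_mxEul ?block_mxEur ?block_mxEdl ?block_mxEdr !mxE ?mulr1n /=;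
rewrite ?ltn_ord ?(eqn_add2l) ?ltnNge ?leq_addr ?addKn //=.
  by rewrite (_ : _ == _ = false)//; apply/negbTE/eqP; have := ltn_ord i'; lia.
by rewrite (_ : _ == _ = false)//; apply/negbTE/eqP; have := ltn_ord j'; lia.
Qed.

Let fmx_block n m n' m' (A : 'M[R]_(m, n)) (B : 'M[R]_(m', n')) phi psi :
  (forall j, (j < n -> phi j < m)%N) ->
  is_fmx A phi -> is_fmx B psi ->
  is_fmx (block_mx A 0 0 B)
    (fun j => if (j < n)%N then phi j else (m + psi (j - n))%N).
Proof.
move=> phim hA hB i j; case: (split_ordP j) => j' ->; case: (split_ordP i) => i' ->;
rewrite ?block_mxEul ?block_mxEur ?block_mxEdl ?block_mxEdr ?mxE /=;
rewrite ?ltn_ord ?ltnNge ?leq_addr/= ?addKn ?eqn_add2l ?hA ?hB //.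
  rewrite (_ : _ == _ = false)//; apply/negbTE/eqP.
  by have := phim _ (ltn_ord j'); lia.
by rewrite (_ : _ == _ = false)//; apply/negbTE/eqP; have := ltn_ord i'; lia.
Qed.

Let fmx_cast n m n' m' (e : (m = m') * (n = n')) (A : 'M[R]_(m, n)) phi :
  is_fmx A phi -> is_fmx (castmx e A) phi.
Proof. by move=> hA i j; rewrite castmxE hA. Qed.

Let fmx_eq n m (A B : 'M[R]_(m, n)) phi psi :
  is_fmx A phi -> is_fmx B psi ->
  (forall j, (j < n)%N -> phi j = psi j) -> A = B.
Proof. by move=> hA hB e; apply/matrixP => i j; rewrite hA hB e. Qed.

Lemma fstoch_lawP n m (f g : smc_hom fstoch_ops n m) : ssmc_law f g -> f = g.
Proof.
case=> {n m f g}; intros; apply: val_inj => /=; rewrite ?hcast_stochE /= ?hcast_stochE /=.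
- by rewrite mulmxA.
- by rewrite mulmx1.
- by rewrite mul1mx.
- by rewrite -scalar_mx_block.
- by rewrite mulmx_block !(mulmx0, mul0mx, addr0, add0r).
- apply/matrixP => i j; rewrite castmxE.
  have [i' ei] : exists i', i = cast_ord (addnA m m' m'') i'.
    by exists (cast_ord (esym (addnA m m' m'')) i); rewrite cast_ordKV.
  have [j' ej] : exists j', j = cast_ord (addnA n n' n'') j'.
    by exists (cast_ord (esym (addnA n n' n'')) j); rewrite cast_ordKV.
  have csti p q r (x : 'I_p) : cast_ord (addnA p q r) (lshift (q + r)%N x) =
      lshift r (lshift q x) by apply: val_inj.
  have cstj p q r (x : 'I_q) : cast_ord (addnA p q r) (rshift p (lshift r x)) =
      lshift r (rshift p x) by apply: val_inj.
  have cstk p q r (x : 'I_r) : cast_ord (addnA p q r) (rshift p (rshift q x)) =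
      rshift (p + q)%N x by apply: val_inj; rewrite /= addnA.
  rewrite ei ej !cast_ordK {i j ei ej}.
  case: (split_ordP i') => [i ->|i0 ->]; [|case: (split_ordP i0) => i ->];
  (case: (split_ordP j') => [j ->|j0 ->]; [|case: (split_ordP j0) => j ->]);
  rewrite ?csti ?cstj ?cstk;
  by rewrite !(block_mxEul, block_mxEur, block_mxEdl, block_mxEdr, mxE).
- apply/matrixP => i j.
  have -> : i = rshift 0 i by apply: val_inj.
  have -> : j = rshift 0 j by apply: val_inj.
  by rewrite block_mxEdr; congr (f _ _); apply: val_inj.
- apply/matrixP => i j; rewrite castmxE.
  have -> : cast_ord (esym (addn0 m)) i = lshift 0 i by apply: val_inj.
  have -> : cast_ord (esym (addn0 n)) j = lshift 0 j by apply: val_inj.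
  by rewrite block_mxEul.
- by rewrite !mulmx_block !(mulmx0, mul0mx, addr0, add0r, mul1mx, mulmx1).
- by rewrite mulmx_block !(mulmx0, mul0mx, addr0, add0r, mul1mx) -scalar_mx_block.
- apply: (@fmx_eq n n _ _ _ _ _ (@fmx_1 n)).
    by apply: (@fmx_cast _ _ n n); exact: fmx_symm.
  move=> j ? /=.
  by case: ifP => //; lia.
- have s1 := fmx_block (B := 1%:M) _ (@fmx_symm n m) (@fmx_1 k).
  have s2 := fmx_block (A := 1%:M) _ (@fmx_1 m) (@fmx_symm n k).
  apply: (fmx_eq (@fmx_symm n (m + k)%N)).
    apply/fmx_cast/fmx_mul; first last.
    + by apply: fmx_cast; apply: s2.
    + by apply: s1 => j; case: ifP; lia.
    + by move=> j /=; repeat case: ifP; lia.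
  by move=> j /=; repeat case: ifP; lia.
Qed.

Definition FStoch : ssmc := Ssmc fstoch_lawP.

End FStoch.

(** * Terms over the signature of convex algebras *)

Section Terms.
Variable R : realType.

Variant gen : nat -> nat -> Type :=
| g_eta : gen 0 1
| g_mu : gen 2 1
| g_c (p : {i01 R}) : gen 1 2.

Inductive term : nat -> nat -> Type :=
| t_gen n m : gen n m -> term n m
| t_id n : term n n
| t_comp n m k : term n m -> term m k -> term n k
| t_tens n m n' m' : term n m -> term n' m' -> term (n + n')%N (m + m')%N
| t_symm n m : term (n + m)%N (m + n)%N.

Definition term_ops : smc_ops := SmcOps t_id t_comp t_tens t_symm.

Definition t_c (p : {i01 R}) : term 1 2 := t_gen (g_c p).

Lemma stoch_eta_subproof : column_stochastic (0 : 'M[R]_(1, 0)).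
Proof. by apply/forallP => -[]. Qed.

Lemma stoch_mu_subproof : column_stochastic (const_mx 1 : 'M[R]_(1, 2)).
Proof.
apply/column_stochasticP; split=> [j|i j]; last by rewrite mxE ler01.
by rewrite big_ord1 mxE.
Qed.

Lemma stoch_c_subproof (p : {i01 R}) :
  column_stochastic
    (\col_i (if i == 0 then p%:num else 1 - p%:num) : 'M[R]_(2, 1)).
Proof.
apply/column_stochasticP; split=> [j|i j].
  by rewrite !big_ord_recl big_ord0 !mxE/= addr0 addrC subrK.
by rewrite !mxE; case: ifP => _; rewrite ?subr_ge0.
Qed.

Definition gen_interp n m (s : gen n m) : stoch R n m :=
  match s with
  | g_eta => Stoch stoch_eta_subproof
  | g_mu => Stoch stoch_mu_subproof
  | g_c p => Stoch (stoch_c_subproof p)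
  end.

Fixpoint interp n m (f : term n m) : smc_hom (FStoch R) n m :=
  match f with
  | t_gen _ _ s => gen_interp s
  | t_id n => smc_id n
  | t_comp _ _ _ f g => interp f ;; interp g
  | t_tens _ _ _ _ f g => interp f [x] interp g
  | t_symm n m => smc_symm n m
  end.

Definition equations := forall n m, term n m -> term n m -> Prop.

Inductive mcong (E : equations) : equations :=
| mc_ax n m (f g : term n m) : E n m f g -> mcong E f g
| mc_law n m (f g : term n m) : @ssmc_law term_ops n m f g -> mcong E f g
| mc_refl n m (f : term n m) : mcong E f f
| mc_sym n m (f g : term n m) : mcong E f g -> mcong E g f
| mc_trans n m (f g h : term n m) : mcong E f g -> mcong E g h -> mcong E f h
| mc_comp n m k (f f' : term n m) (g g' : term m k) :
    mcong E f f' -> mcong E g g' -> mcong E (t_comp f g) (t_comp f' g')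
| mc_tens n m n' m' (f f' : term n m) (g g' : term n' m') :
    mcong E f f' -> mcong E g g' -> mcong E (t_tens f g) (t_tens f' g').

(* Fritz: his presentation of convex algebras has this property, and it is the
   only property of the presentation that matters here. *)
Definition axiomatises_FStoch (E : equations) :=
  forall n m (f g : term n m), mcong E f g <-> interp f = interp g.

(** * Quantitative monoidal theories *)

Inductive judgment :=
| JEq n m of term n m & term n m
| JQeq n m of \bar R & term n m & term n m.

(* A theory is a set of axioms [(G, j)]: from the judgments in [G], infer [j]. *)
Definition theory := set judgment -> judgment -> Prop.

Local Open Scope ereal_scope.

Inductive der (T : theory) : judgment -> Prop :=
| d_ax G j : T G j -> (forall k, G k -> der T k) -> der T j
| d_law n m (f g : term n m) : @ssmc_law term_ops n m f g -> der T (JEq f g)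
| d_refl n m (f : term n m) : der T (JEq f f)
| d_sym n m (f g : term n m) : der T (JEq f g) -> der T (JEq g f)
| d_trans n m (f g h : term n m) :
    der T (JEq f g) -> der T (JEq g h) -> der T (JEq f h)
| d_comp n m k (f f' : term n m) (g g' : term m k) :
    der T (JEq f f') -> der T (JEq g g') -> der T (JEq (t_comp f g) (t_comp f' g'))
| d_tens n m n' m' (f f' : term n m) (g g' : term n' m') :
    der T (JEq f f') -> der T (JEq g g') -> der T (JEq (t_tens f g) (t_tens f' g'))
| d_repl_l n m (f f' g : term n m) eps :
    der T (JEq f f') -> der T (JQeq eps f g) -> der T (JQeq eps f' g)
| d_repl_r n m (f g g' : term n m) eps :
    der T (JEq g g') -> der T (JQeq eps f g) -> der T (JQeq eps f g')
| d_mono n m (f g : term n m) eps eps' :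
    eps <= eps' -> der T (JQeq eps f g) -> der T (JQeq eps' f g)
| d_cont n m (f g : term n m) (I : Type) (eps : I -> \bar R) :
    (forall i, der T (JQeq (eps i) f g)) ->
    der T (JQeq (ereal_inf (range eps)) f g)
| d_nexp_comp n m k (f f' : term n m) (g g' : term m k) eps del :
    der T (JQeq eps f f') -> der T (JQeq del g g') ->
    der T (JQeq (eps + del) (t_comp f g) (t_comp f' g'))
| d_nexp_tens n m n' m' (f f' : term n m) (g g' : term n' m') eps del :
    der T (JQeq eps f f') -> der T (JQeq del g g') ->
    der T (JQeq (eps + del) (t_tens f g) (t_tens f' g')).

Definition dist (T : theory) n m (f g : term n m) : \bar R :=
  ereal_inf [set eps | 0 <= eps /\ der T (JQeq eps f g)].

End Terms.

Arguments t_id {R}.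
Arguments t_symm {R}.

(** * The syntactic category *)

(* Classical choice structure on terms, required by [{eq_quot _}]. *)
HB.instance Definition _ (R : realType) n m := gen_eqMixin (term R n m).
HB.instance Definition _ (R : realType) n m := gen_choiceMixin (term R n m).

Section Syn.
Variables (R : realType) (T : theory R).

Definition syn_eq n m : rel (term R n m) := fun f g => `[< der T (JEq f g) >].

Lemma syn_eq_refl n m : reflexive (@syn_eq n m).
Proof. by move=> f; apply/asboolP/d_refl. Qed.

Lemma syn_eq_sym n m : symmetric (@syn_eq n m).
Proof. by move=> f g; apply/asboolP/asboolP => /d_sym. Qed.

Lemma syn_eq_trans n m : transitive (@syn_eq n m).
Proof. by move=> g f h /asboolP fg /asboolP /(d_trans fg) fh; apply/asboolP. Qed.

Canonical syn_equiv n m :=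
  EquivRel (@syn_eq n m) (@syn_eq_refl n m) (@syn_eq_sym n m) (@syn_eq_trans n m).

Definition syn_hom n m := {eq_quot (syn_equiv n m)}.

Definition syn_class n m (f : term R n m) : syn_hom n m := \pi f.

Definition syn_repr n m (x : syn_hom n m) : term R n m := repr x.

Lemma syn_reprK n m (x : syn_hom n m) : syn_class (syn_repr x) = x.
Proof. exact: reprK. Qed.

Lemma syn_classP n m (f g : term R n m) :
  syn_class f = syn_class g <-> der T (JEq f g).
Proof.
rewrite /syn_class; split=> [/eqmodP/asboolP//|fg].
by apply/eqmodP/asboolP.
Qed.

Lemma syn_classK n m (f : term R n m) :
  der T (JEq (syn_repr (syn_class f)) f).
Proof. by apply/syn_classP; rewrite syn_reprK. Qed.

Definition syn_ops : smc_ops := @SmcOps syn_hom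
  (fun n => syn_class (t_id n))
  (fun n m k x y => syn_class (t_comp (syn_repr x) (syn_repr y)))
  (fun n m n' m' x y => syn_class (t_tens (syn_repr x) (syn_repr y)))
  (fun n m => syn_class (t_symm n m)).

Lemma syn_compE n m k (f : term R n m) (g : term R m k) :
  (syn_class f : smc_hom syn_ops _ _) ;; syn_class g = syn_class (t_comp f g).
Proof. by apply/syn_classP/d_comp; exact: syn_classK. Qed.

Lemma syn_tensE n m n' m' (f : term R n m) (g : term R n' m') :
  (syn_class f : smc_hom syn_ops _ _) [x] syn_class g = syn_class (t_tens f g).
Proof. by apply/syn_classP/d_tens; exact: syn_classK. Qed.

Lemma hcast_synE n m n' m' (en : n = n') (em : m = m') (f : term R n m) :
  hcast en em (syn_class f) = syn_class (hcast en em f).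
Proof. by case: n' / en; case: m' / em. Qed.

Lemma syn_lawP n m (f g : smc_hom syn_ops n m) : ssmc_law f g -> f = g.
Proof.
have idE k : (smc_id k : smc_hom syn_ops k k) = syn_class (t_id k) by [].
have symmE k l : (smc_symm k l : smc_hom syn_ops _ _) = syn_class (t_symm k l) by [].
have reprE k l (x : smc_hom syn_ops k l) : exists t, x = syn_class t.
  by exists (syn_repr x); rewrite syn_reprK.
case=> {n m f g}; intros;
repeat match goal with x : smc_hom syn_ops _ _ |- _ =>
  let t := fresh "t" in let e := fresh "e" in
  have [t e] := reprE _ _ x; subst x end;
rewrite ?idE ?symmE;
repeat match goal with
| |- context [syn_class ?f ;; syn_class ?g] => rewrite (syn_compE f g)
| |- context [syn_class ?f [x] syn_class ?g] => rewrite (syn_tensE f g)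
| |- context [hcast ?en ?em (syn_class ?f)] => rewrite (hcast_synE en em f)
end;
apply/syn_classP/d_law.
- exact: (@law_compA (term_ops R)).
- exact: (@law_idl (term_ops R)).
- exact: (@law_idr (term_ops R)).
- exact: (@law_tens_id (term_ops R)).
- exact: (@law_interchange (term_ops R)).
- exact: (@law_tensA (term_ops R)).
- exact: (@law_tens0l (term_ops R)).
- exact: (@law_tens0r (term_ops R)).
- exact: (@law_symm_nat (term_ops R)).
- exact: (@law_symmK (term_ops R)).
- exact: (@law_symm0 (term_ops R)).
- exact: (@law_hexagon (term_ops R)).
Qed.

Definition Syn : ssmc := Ssmc syn_lawP.

End Syn.

(** * Renyi divergences and the theory axiomatising them

    The conventions on [0] and [+oo] are those of [\bar R]: [0^-1 = +oo],
    [+oo^-1 = 0] and [0 * +oo = 0], hence [x / 0] is [0] if [x = 0] and [+oo]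
    if [0 < x]; moreover [lne 0 = -oo], [lne +oo = +oo] and
    [-oo + +oo = -oo]. *)

Section Renyi.
Variable R : realType.
Local Open Scope ereal_scope.

(* [powR] maps a null base to [0] for every nonzero exponent. *)
Definition epow (q r : R) : \bar R :=
  if (q == 0%R) && (r < 0)%R then +oo else (q `^ r)%:E.

(* p ^ a / q ^ (a - 1), where [0 ^ a = 0] also for [a = 0], in accordance with
   the sum over [0 < mu x] in the divergence of order 0. *)
Definition renyi_ratio (a p q : R) : \bar R :=
  (if p == 0%R then 0 else (p `^ a)%:E) / epow q (a - 1).

(* The value at -oo is a dummy. *)
Definition renyi (alpha : \bar R) (X : finType) (mu nu : X -> R) : \bar R :=
  match alpha with
  | a%:E =>
      if a == 0%R then - lne (\sum_(x | (0 < mu x)%R) (nu x)%:E)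
      else ((a - 1)^-1)%:E * lne (\sum_x renyi_ratio a (mu x) (nu x))
  | +oo => ereal_sup (range (fun x => lne ((mu x)%:E / (nu x)%:E)))
  | -oo => 0
  end.

Definition renyi_max (alpha : \bar R) m n (A B : 'M[R]_(m, n)) : \bar R :=
  if (n == 0)%N || (m == 0)%N then 0
  else \big[maxe/-oo]_(j < n) renyi alpha (fun x => A x j) (fun x => B x j).

(* The value at alpha = -oo is a dummy. *)
Definition chain_bound (alpha : \bar R) (p q : R) (eps del : \bar R) : \bar R :=
  match alpha with
  | a%:E =>
      ((a - 1)^-1)%:E *
      lne (renyi_ratio a p q * expeR ((a - 1)%:E * eps) +
           renyi_ratio a (1 - p) (1 - q) * expeR ((a - 1)%:E * del))
  | +oo =>
      maxe (lne (p%:E / q%:E) + eps) (lne ((1 - p)%:E / (1 - q)%:E) + del)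
  | -oo => 0
  end.

Inductive renyi_theory (TCA : equations R) (alpha : \bar R) : theory R :=
| rt_CA n m (f g : term R n m) :
    TCA n m f g -> renyi_theory TCA alpha set0 (JEq f g)
| rt_zero n m (f : term R n m) : renyi_theory TCA alpha set0 (JQeq 0 f f)
| rt_chain n m (f g : term R 1 n) (f' g' : term R 1 m) (p q : {i01 R}) eps del :
    0 <= eps -> 0 <= del ->
    renyi_theory TCA alpha [set JQeq eps f g; JQeq del f' g']
      (JQeq (chain_bound alpha p%:num q%:num eps del)
         (t_comp (t_c p) (t_tens f f')) (t_comp (t_c q) (t_tens g g')))
| rt_parmax n m n' m' (f g : term R n m) (f' g' : term R n' m') eps del :
    0 <= eps -> 0 <= del ->
    renyi_theory TCA alpha [set JQeq eps f g; JQeq del f' g']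
      (JQeq (maxe eps del) (t_tens f f') (t_tens g g')).

End Renyi.

(* Main.v *)
(* Let r(p, q) = p ^ a / q ^ (a - 1), so that R_a is the image under
   s |-> log s / (a - 1) of the sum of r over the points; this map is increasing
   once the order on its argument is reversed for a < 1. The function r is multiplicative and, being
   homogeneous and above its tangent plane along the diagonal (below, for a < 1),
   superadditive up to the same reversal. This gives R_a >= 0 and
   R_a(B mu, B' nu) <= R_a(mu, nu) + max_x R_a(B_x, B'_x), which validates
   nonexpansiveness, and the chain rule
   R_a(p f + (1 - p) f', q g + (1 - q) g') = C_a(p, q, R_a(f, g), R_a(f', g')).
   For a = oo the same facts follow from
   R_oo(mu, nu) <= e <-> mu <= exp(e) nu pointwise.

   Conversely, peeling off one outcome at a time, the chain rule lets Chain
   derive the exact distance of two columns; a matrix is the parallel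
   composition of its columns followed by the codiagonal m + m -> m, so that
   Parmax and nonexpansiveness yield the exact distance of matrices. *)
Require Import Defs.
From mathcomp Require Import all_boot all_order all_algebra.
From mathcomp Require Import zify ring lra.
From mathcomp Require Import boolp classical_sets reals constructive_ereal ereal.
From mathcomp Require Import interval_inference sequences exp.

Set Implicit Arguments.
Unset Strict Implicit.
Unset Printing Implicit Defensive.

Import Order.TTheory GRing.Theory Num.Theory.

Local Open Scope ring_scope.
Local Open Scope ereal_scope.

(** * Finite distributions *)

Section Distributions.
Variable R : realType.

Definition distr (X : finType) (mu : X -> R) :=
  (forall x, 0 <= mu x)%R /\ (\sum_x mu x = 1)%R.

Lemma distr_comp (X Y : finType) (mu : X -> R) (B : X -> Y -> R) :
  distr mu -> (forall x, distr (B x)) -> distr (fun y => \sum_x B x y * mu x)%R.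
Proof.
move=> [mu0 mu1] dB; split=> [y|].
  by apply: sumr_ge0 => x _; rewrite mulr_ge0//; have [] := dB x.
rewrite exchange_big/= -[RHS]mu1; apply: eq_bigr => x _.
by rewrite -mulr_suml; have [_ ->] := dB x; rewrite mul1r.
Qed.

(** The column denoted by [t_comp (t_c p) (t_tens f g)]: a biased choice between two branches whose
    outcomes stay disjoint. *)
Definition mixture n m (p : R) (f : 'I_n -> R) (g : 'I_m -> R) (x : 'I_(n + m)) : R :=
  match split x with inl i => (p * f i)%R | inr i => ((1 - p) * g i)%R end.

Lemma mixturel n m p (f : 'I_n -> R) (g : 'I_m -> R) i :
  mixture p f g (lshift m i) = (p * f i)%R.
Proof. by rewrite /mixture (unsplitK (inl i)). Qed.

Lemma mixturer n m p (f : 'I_n -> R) (g : 'I_m -> R) i :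
  mixture p f g (rshift n i) = ((1 - p) * g i)%R.
Proof. by rewrite /mixture (unsplitK (inr i)). Qed.

Lemma distr_mixture n m p (f : 'I_n -> R) (g : 'I_m -> R) :
  (0 <= p <= 1)%R -> distr f -> distr g -> distr (mixture p f g).
Proof.
move=> /andP[p0 p1] [f0 f1] [g0 g1]; split=> [x|].
  by case: (split_ordP x) => i ->; rewrite ?mixturel ?mixturer mulr_ge0// subr_ge0.
rewrite big_split_ord/=.
under eq_bigr do rewrite mixturel.
under [X in (_ + X)%R]eq_bigr do rewrite mixturer.
by rewrite -!mulr_sumr f1 g1 !mulr1 addrC subrK.
Qed.

End Distributions.


(** * Divergences of finite order *)

Section FiniteOrder.
Variables (R : realType) (a : R).
Hypotheses (a_ge0 : (0 <= a)%R) (a_neq1 : a != 1%R).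

(* The order on [0, +oo] for which [rlog] is increasing. *)
Definition rord (s t : \bar R) := if (1 < a)%R then s <= t else t <= s.

(** [rlog] turns a sum of ratios into a divergence and [rexp] inverts it on [[0, +oo]], so bounds on
    divergences become [rord] bounds on sums. *)
Definition rlog (s : \bar R) : \bar R := ((a - 1)^-1)%:E * lne s.
Definition rexp (eps : \bar R) : \bar R := expeR ((a - 1)%:E * eps).

Lemma rord_refl s : rord s s.
Proof. by rewrite /rord; case: ifP. Qed.

Lemma rord_trans t s u : rord s t -> rord t u -> rord s u.
Proof.
by rewrite /rord; case: ifP => _ st tu; [exact: le_trans tu|exact: le_trans st].
Qed.

Lemma rordD s t s' t' : rord s t -> rord s' t' -> rord (s + s') (t + t').
Proof. by rewrite /rord; case: ifP => _; exact: leeD. Qed.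

Lemma rord_sum (I : finType) (F G : I -> \bar R) :
  (forall i, rord (F i) (G i)) -> rord (\sum_i F i) (\sum_i G i).
Proof. by rewrite /rord; case: ifP => _ FG; apply: lee_sum. Qed.

Lemma rordM u s t : 0 <= u -> rord s t -> rord (u * s) (u * t).
Proof. by move=> u0; rewrite /rord; case: ifP => _; exact: lee_wpmul2l. Qed.

Lemma rordMr u s t : 0 <= u -> rord s t -> rord (s * u) (t * u).
Proof. by rewrite !(muleC _ u); exact: rordM. Qed.

Lemma order_gt1_or_lt1 : (1 < a)%R \/ ~~ (1 < a)%R /\ (a < 1)%R.
Proof.
case: ltP => [|a1]; [by left|right; split=> //].
by rewrite lt_neqAle a_neq1.
Qed.

Lemma subr1_neq0 : (a - 1)%R != 0%R.
Proof. by rewrite subr_eq0. Qed.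

Lemma rlogK s : 0 <= s -> rexp (rlog s) = s.
Proof.
move=> s0; rewrite /rexp /rlog muleA -EFinM mulfV ?subr1_neq0// mul1e.
by rewrite lneK// in_itv/= s0 leey.
Qed.

Lemma rexpK eps : rlog (rexp eps) = eps.
Proof.
by rewrite /rexp /rlog expeRK muleA -EFinM mulVf ?subr1_neq0// mul1e.
Qed.

Lemma rlog1 : rlog 1 = 0.
Proof. by rewrite /rlog lne1 mule0. Qed.

Lemma rexp_ge0 eps : 0 <= rexp eps.
Proof. exact: expeR_ge0. Qed.

Lemma le_rexp eps eps' : eps <= eps' -> rord (rexp eps) (rexp eps').
Proof.
rewrite /rord /rexp => le; case: order_gt1_or_lt1 => [a1|[/negbTE a1 a1']].
  by rewrite a1 lee_expeR lee_wpmul2l// lee_fin subr_ge0 ltW.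
have -> : (a - 1 = - (1 - a))%R by ring.
by rewrite a1 lee_expeR EFinN !mulNe leeN2 lee_wpmul2l// lee_fin subr_ge0 ltW.
Qed.

Lemma rord_rlog s t : 0 <= s -> 0 <= t -> rord s t -> rlog s <= rlog t.
Proof.
move=> s0 t0; have L : forall x : \bar R, 0 <= x -> x \in `[0, +oo].
  by move=> x x0; rewrite in_itv/= x0 leey.
rewrite /rord /rlog; case: order_gt1_or_lt1 => [a1|[/negbTE a1 a1']]; rewrite ?a1 => st.
  by rewrite lee_wpmul2l ?lee_lne ?L// lee_fin invr_ge0 subr_ge0 ltW.
have -> : (a - 1 = - (1 - a))%R by ring.
rewrite invrN EFinN !mulNe leeN2 lee_wpmul2l ?lee_lne ?L//.
by rewrite lee_fin invr_ge0 subr_ge0 ltW.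
Qed.

Lemma rlog_leP s eps : 0 <= s -> rlog s <= eps <-> rord s (rexp eps).
Proof.
move=> s0; split=> [/le_rexp|se]; first by rewrite rlogK.
by rewrite -(rexpK eps) rord_rlog// rexp_ge0.
Qed.

Lemma rexpD eps del : 0 <= eps -> 0 <= del ->
  rexp (eps + del) = rexp eps * rexp del.
Proof. by move=> e0 d0; rewrite /rexp ge0_muleDr// expeRD. Qed.

(** * Multiplicativity and superadditivity of the ratio function *)

Notation ratio := (renyi_ratio a).

Lemma epow_ge0 (q r : R) : 0 <= epow q r.
Proof. by rewrite /epow; case: ifP => // _; rewrite lee_fin powR_ge0. Qed.

Lemma ratio_ge0 p q : 0 <= ratio p q.
Proof.
rewrite mule_ge0 ?inve_ge0 ?epow_ge0//.
by case: ifP => // _; rewrite lee_fin powR_ge0.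
Qed.

Lemma sum_ratio_ge0 (I : finType) (p q : I -> R) :
  0 <= \sum_i ratio (p i) (q i).
Proof. by apply: sume_ge0 => i _; exact: ratio_ge0. Qed.

Lemma ratio0 q : ratio 0 q = 0.
Proof. by rewrite /renyi_ratio eqxx mul0e. Qed.

Lemma ratio_pos p q : (0 < p)%R -> (0 < q)%R ->
  ratio p q = (expR (a * ln p + (1 - a) * ln q))%:E.
Proof.
move=> p0 q0; rewrite /renyi_ratio /epow !gt_eqF//= inver.
rewrite gt_eqF ?powR_gt0// -EFinM; congr EFin.
rewrite -powRN /powR !gt_eqF// -expRD; congr expR; ring.
Qed.

(** The divisor [epow 0 (a - 1)] is 0 for [1 < a] and [+oo] for [a < 1]. *)
Lemma ratio_pos0 p : (0 < p)%R -> ratio p 0 = if (1 < a)%R then +oo else 0.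
Proof.
move=> p0; rewrite /renyi_ratio /epow eqxx gt_eqF//=.
case: order_gt1_or_lt1 => [a1|[/negbTE a1 a1']].
  rewrite a1 ltNge subr_ge0 (ltW a1)/= powR0 ?subr1_neq0// inve0.
  by rewrite gt0_muley// lte_fin powR_gt0.
by rewrite a1 subr_lt0 a1' invey mule0.
Qed.

Lemma ratioxx p : (0 <= p)%R -> ratio p p = p%:E.
Proof.
rewrite le_eqVlt => /predU1P[<-|p0]; first by rewrite ratio0.
rewrite ratio_pos//; congr EFin; rewrite -[RHS]lnK ?posrE//; congr expR; ring.
Qed.

Lemma ratioM p q p' q' : (0 <= p)%R -> (0 <= q)%R -> (0 <= p')%R -> (0 <= q')%R ->
  ratio (p * p') (q * q') = ratio p q * ratio p' q'.
Proof.
rewrite le_eqVlt => /predU1P[<-|p0]; first by rewrite mul0r !ratio0 mul0e.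
move=> q0; rewrite le_eqVlt => /predU1P[<-|p'0].
  by rewrite mulr0 !ratio0 mule0.
(* For [1 < a] a factor may be [+oo], and its product with the other factor is [+oo] only because
   that one is nonzero. *)
have H u v : (0 < u)%R -> (0 <= v)%R -> (1 < a)%R -> ratio u v != 0.
  move=> u0; rewrite le_eqVlt => /predU1P[<-|v0] a1.
    by rewrite ratio_pos0// a1.
  by rewrite ratio_pos// gt_eqF// lte_fin expR_gt0.
move: q0; rewrite le_eqVlt => /predU1P[<-|q0] q'0.
  rewrite mul0r !ratio_pos0 ?mulr_gt0//; case: ifP => a1; rewrite ?mul0e//.
  by rewrite muleC gt0_muley// lt_neqAle ratio_ge0 eq_sym H.
move: q'0; rewrite le_eqVlt => /predU1P[<-|q'0].
  rewrite mulr0 !ratio_pos0 ?mulr_gt0//; case: ifP => a1; rewrite ?mule0//.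
  by rewrite gt0_muley// lt_neqAle ratio_ge0 eq_sym H// ltW.
rewrite !ratio_pos ?mulr_gt0// -EFinM -expRD !lnM ?posrE//.
by congr EFin; congr expR; ring.
Qed.

(* The graph of (x, y) |-> x ^ a / y ^ (a - 1) lies above (below, if a < 1)
   its tangent plane along the diagonal. *)
Lemma ratio_tangent (x y : R) : (0 <= x)%R -> (0 <= y)%R ->
  rord (y + a * (x - y))%:E (ratio x y).
Proof.
rewrite /rord le_eqVlt => /predU1P[<-|x0].
  move=> y0; rewrite ratio0 (_ : (y + a * (0 - y) = (1 - a) * y)%R); last by ring.
  case: order_gt1_or_lt1 => [a1|[/negbTE a1 a1']]; rewrite a1 lee_fin.
    by rewrite mulr_le0_ge0// subr_le0 ltW.
  by rewrite mulr_ge0// subr_ge0 ltW.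
rewrite le_eqVlt => /predU1P[<-|y0].
  rewrite ratio_pos0//; case: order_gt1_or_lt1 => [a1|[/negbTE a1 a1']];
    rewrite a1 ?leey//.
  by rewrite lee_fin add0r subr0 mulr_ge0// ltW.
rewrite ratio_pos//; set L := (a * ln x + (1 - a) * ln y)%R.
(* [E] and [E'] are [1 + t <= expR t] at [t = u - ln v] and [t = ln v - u], rescaled by [v] and by
   [expR u]. *)
have E (u v : R) : (0 < v)%R -> (v * (1 + (u - ln v)) <= expR u)%R.
  move=> v0; have {2}-> : u = (ln v + (u - ln v))%R by ring.
  by rewrite expRD lnK ?posrE// ler_pM2l// expR_ge1Dx.
have E' (u v : R) : (0 < v)%R -> (expR u * (1 + (ln v - u)) <= v)%R.
  move=> v0; rewrite -[leRHS]lnK ?posrE//.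
  have {2}-> : ln v = (u + (ln v - u))%R by ring.
  by rewrite expRD ler_pM2l ?expR_gt0// expR_ge1Dx.
case: order_gt1_or_lt1 => [a1|[/negbTE a1 a1']]; rewrite a1 lee_fin.
  (* Since [L - ln x = (a - 1) * (ln x - ln y)], adding the two bounds with weights 1 and [a - 1]
     cancels all logarithms. *)
  have h1 := E L x x0; have := E (ln y) x x0; rewrite lnK ?posrE// => h2.
  have h3 : ((a - 1) * (x * (1 + (ln y - ln x))) <= (a - 1) * y)%R.
    by rewrite ler_wpM2l// subr_ge0 ltW.
  have h4 : (x * (1 + (L - ln x)) + (a - 1) * (x * (1 + (ln y - ln x))) = a * x)%R.
    by rewrite /L; ring.
  lra.
(* For [a < 1] the claim is the weighted mean inequality [x ^ a * y ^ (1 - a) <= a * x + (1 - a) *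
   y]. *)
have h1 : (a * (expR L * (1 + (ln x - L))) <= a * x)%R by rewrite ler_wpM2l// E'.
have h2 : ((1 - a) * (expR L * (1 + (ln y - L))) <= (1 - a) * y)%R.
  by rewrite ler_wpM2l ?E'//; lra.
have h3 : (a * (expR L * (1 + (ln x - L))) + (1 - a) * (expR L * (1 + (ln y - L))) =
    expR L)%R by rewrite {2 4}/L; ring.
lra.
Qed.

(** The tangent planes sum to 1 because the differences [p i - q i] sum to 0; nonnegativity of the
    divergence comes from here. *)
Lemma sum_ratio_ge1 (I : finType) (p q : I -> R) :
  (forall i, 0 <= p i)%R -> (forall i, 0 <= q i)%R ->
  (\sum_i p i = 1)%R -> (\sum_i q i = 1)%R ->
  rord 1 (\sum_i ratio (p i) (q i)).
Proof.
move=> p0 q0 p1 q1.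
have -> : 1 = \sum_i (q i + a * (p i - q i))%:E.
  rewrite sumEFin big_split/= -mulr_sumr sumrB p1 q1; congr EFin; ring.
by apply: rord_sum => i; exact: ratio_tangent.
Qed.

(** By multiplicativity [ratio P Q] factors out of the sum, which leaves [sum_ratio_ge1] for the
    normalised families; zero totals are treated apart. *)
Lemma ratio_sum (I : finType) (p q : I -> R) :
  (forall i, 0 <= p i)%R -> (forall i, 0 <= q i)%R ->
  rord (ratio (\sum_i p i) (\sum_i q i)) (\sum_i ratio (p i) (q i)).
Proof.
move=> p0 q0; set P := (\sum_i p i)%R; set Q := (\sum_i q i)%R.
have : (0 <= P)%R by rewrite sumr_ge0.
rewrite le_eqVlt => /predU1P[P0|P0].
  rewrite -P0 ratio0 big1 ?rord_refl// => i _.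
  have /psumr_eq0P : (\sum_i p i = 0)%R by rewrite -/P.
  by move=> -> //; rewrite ratio0.
have : (0 <= Q)%R by rewrite sumr_ge0.
rewrite le_eqVlt => /predU1P[Q0|Q0].
  have q00 i : q i = 0%R.
    by have /psumr_eq0P -> : (\sum_i q i = 0)%R by rewrite -/Q.
  (* With no mass in [q], a single [0 < p j] makes the sum [+oo] if [1 < a], while every term
     vanishes if [a < 1]. *)
  rewrite -Q0 ratio_pos0//.
  have [j pj] : exists j, (0 < p j)%R.
    apply/existsP; apply: contraLR P0; rewrite negb_exists => /forallP h.
    by rewrite -leNgt /P sumr_le0// => i _; rewrite leNgt h.
  rewrite /rord; case: ifP => a1.
    rewrite (bigD1 j)//= q00 ratio_pos0// a1 addye// -ltNye.
    by rewrite (lt_le_trans ltNy0)// sume_ge0// => i _; exact: ratio_ge0.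
  rewrite a1 big1// => i _; rewrite q00; have := p0 i.
  by rewrite le_eqVlt => /predU1P[<-|pi]; rewrite ?ratio0// ratio_pos0// a1.
have -> : \sum_i ratio (p i) (q i) =
    ratio P Q * \sum_i ratio (p i / P) (q i / Q).
  rewrite ge0_sume_distrr; last by move=> i _; exact: ratio_ge0.
  apply: eq_bigr => i _; rewrite -ratioM ?divr_ge0// ?(ltW P0) ?(ltW Q0)//.
  by rewrite !(mulrC _ (_ / _))%R !divfK ?gt_eqF.
suff /(rordM (ratio_ge0 P Q)) : rord 1 (\sum_i ratio (p i / P) (q i / Q)).
  by rewrite mule1.
apply: sum_ratio_ge1 => [i|i||]; rewrite ?divr_ge0// ?(ltW P0) ?(ltW Q0)//.
  by rewrite -mulr_suml mulfV ?gt_eqF.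
by rewrite -mulr_suml mulfV ?gt_eqF.
Qed.

(** Order 0 fits the general formula: there [(a - 1)^-1] is -1 and the ratio is [nu x] where
    [0 < mu x] and 0 elsewhere. *)
Lemma renyi_finE (X : finType) (mu nu : X -> R) :
  (forall x, 0 <= mu x)%R -> (forall x, 0 <= nu x)%R ->
  renyi a%:E mu nu = rlog (\sum_x ratio (mu x) (nu x)).
Proof.
move=> mu0 nu0; rewrite /renyi; case: eqP => // a0.
rewrite /rlog [in (a - 1)%R]a0 sub0r invrN1 mulN1e; congr (- lne _).
rewrite big_mkcond; apply: eq_bigr => x _.
have := mu0 x; rewrite le_eqVlt => /predU1P[<-|m]; first by rewrite ltxx ratio0.
rewrite m; have := nu0 x; rewrite le_eqVlt => /predU1P[<-|n].
  by rewrite ratio_pos0// a0 ltNge ler01.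
by rewrite ratio_pos// a0 mul0r add0r subr0 mul1r lnK.
Qed.


Lemma renyi_fin_ge0 (X : finType) (mu nu : X -> R) :
  distr mu -> distr nu -> 0 <= renyi a%:E mu nu.
Proof.
move=> [mu0 mu1] [nu0 nu1]; rewrite renyi_finE// -[leLHS]rlog1.
by apply: rord_rlog; [exact: lee01|exact: sum_ratio_ge0|exact: sum_ratio_ge1].
Qed.

Lemma renyi_fin_refl (X : finType) (mu : X -> R) :
  distr mu -> renyi a%:E mu mu <= 0.
Proof.
move=> [mu0 mu1]; rewrite renyi_finE//.
rewrite (eq_bigr (fun x => (mu x)%:E)) => [|x _]; last exact: ratioxx.
by rewrite sumEFin mu1 rlog1.
Qed.

Lemma renyi_fin_leP (X : finType) (mu nu : X -> R) eps :
  distr mu -> distr nu ->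
  renyi a%:E mu nu <= eps <-> rord (\sum_x ratio (mu x) (nu x)) (rexp eps).
Proof.
move=> [mu0 _] [nu0 _]; rewrite renyi_finE//; apply: rlog_leP; exact: sum_ratio_ge0.
Qed.

(** Superadditivity pulls the sum over [x] out of the ratio, multiplicativity separates the kernel
    from the input, and the two bounds apply to the inner and the outer sum. *)
Lemma renyi_fin_comp (X Y : finType) (mu nu : X -> R) (B B' : X -> Y -> R) eps del :
  distr mu -> distr nu -> (forall x, distr (B x)) -> (forall x, distr (B' x)) ->
  0 <= eps -> 0 <= del ->
  renyi a%:E mu nu <= eps -> (forall x, renyi a%:E (B x) (B' x) <= del) ->
  renyi a%:E (fun y => \sum_x B x y * mu x)%R (fun y => \sum_x B' x y * nu x)%R
    <= eps + del.
Proof.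
move=> dmu dnu dB dB' e0 d0 /renyi_fin_leP le_eps le_del.
apply/renyi_fin_leP; [exact: distr_comp|exact: distr_comp|].
have [[mu0 _] [nu0 _]] := (dmu, dnu).
have B0 x y : (0 <= B x y)%R by have [] := dB x.
have B'0 x y : (0 <= B' x y)%R by have [] := dB' x.
apply: (@rord_trans (\sum_y \sum_x ratio (B x y * mu x) (B' x y * nu x))).
  by apply: rord_sum => y; apply: ratio_sum => x; rewrite mulr_ge0.
rewrite exchange_big/= rexpD//.
apply: (@rord_trans (\sum_x ratio (mu x) (nu x) * rexp del)); last first.
  rewrite -ge0_sume_distrl; last by move=> x _; exact: ratio_ge0.
  by apply: rordMr; [exact: rexp_ge0|exact: le_eps].
apply: rord_sum => x.
rewrite (eq_bigr (fun y => ratio (mu x) (nu x) * ratio (B x y) (B' x y))); last first.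
  by move=> y _; rewrite muleC -ratioM.
rewrite -ge0_sume_distrr; last by move=> y _; exact: ratio_ge0.
by apply: rordM; [exact: ratio_ge0|apply/renyi_fin_leP].
Qed.

(** The branches occupy disjoint blocks of outcomes, so the sum splits without loss; this makes the
    chain rule exact. *)
Lemma mixture_ratio n m (p q : R) (f g : 'I_n -> R) (f' g' : 'I_m -> R) :
  (0 <= p <= 1)%R -> (0 <= q <= 1)%R ->
  distr f -> distr g -> distr f' -> distr g' ->
  \sum_x ratio (mixture p f f' x) (mixture q g g' x) =
  ratio p q * (\sum_x ratio (f x) (g x)) +
  ratio (1 - p) (1 - q) * (\sum_x ratio (f' x) (g' x)).
Proof.
move=> /andP[p0 p1] /andP[q0 q1] [f0 _] [g0 _] [f'0 _] [g'0 _].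
rewrite big_split_ord/=; congr (_ + _);
  rewrite ge0_sume_distrr; try by move=> *; exact: ratio_ge0.
  by apply: eq_bigr => x _; rewrite !mixturel ratioM.
by apply: eq_bigr => x _; rewrite !mixturer ratioM// subr_ge0.
Qed.

Lemma chain_bound_finE p q eps del : chain_bound a%:E p q eps del =
  rlog (ratio p q * rexp eps + ratio (1 - p) (1 - q) * rexp del).
Proof. by []. Qed.

Lemma renyi_fin_chain_le n m (p q : R) (f g : 'I_n -> R) (f' g' : 'I_m -> R) eps del :
  (0 <= p <= 1)%R -> (0 <= q <= 1)%R ->
  distr f -> distr g -> distr f' -> distr g' ->
  renyi a%:E f g <= eps -> renyi a%:E f' g' <= del ->
  renyi a%:E (mixture p f f') (mixture q g g') <= chain_bound a%:E p q eps del.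
Proof.
move=> p01 q01 df dg df' dg' /renyi_fin_leP fg /renyi_fin_leP fg'.
have [m0 _] := distr_mixture p01 df df'.
have [n0 _] := distr_mixture q01 dg dg'.
rewrite renyi_finE// chain_bound_finE; apply: rord_rlog.
- exact: sum_ratio_ge0.
- by rewrite adde_ge0// mule_ge0 ?ratio_ge0 ?rexp_ge0.
rewrite mixture_ratio//; apply: rordD; apply: rordM; rewrite ?ratio_ge0//.
  exact: fg.
exact: fg'.
Qed.

(** At the exact divergences [rlogK] recovers the two ratio sums, and both sides become the same
    expression. *)
Lemma renyi_fin_chain_ge n m (p q : R) (f g : 'I_n -> R) (f' g' : 'I_m -> R) :
  (0 <= p <= 1)%R -> (0 <= q <= 1)%R ->
  distr f -> distr g -> distr f' -> distr g' ->
  chain_bound a%:E p q (renyi a%:E f g) (renyi a%:E f' g') <=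
  renyi a%:E (mixture p f f') (mixture q g g').
Proof.
move=> p01 q01 df dg df' dg'.
have [m0 _] := distr_mixture p01 df df'.
have [n0 _] := distr_mixture q01 dg dg'.
have [[f0 _] [g0 _] [f'0 _] [g'0 _]] := And4 df dg df' dg'.
by rewrite !renyi_finE// chain_bound_finE !rlogK ?mixture_ratio// sum_ratio_ge0.
Qed.

End FiniteOrder.

(** * The divergence of infinite order *)

Section InfiniteOrder.
Variable R : realType.
Local Notation renyi_oo := (renyi (+oo : \bar R)).

(** At the endpoints this rests on [0 * +oo = 0] matching [-oo + +oo = -oo]. *)
Lemma lneM_ge0 (s t : \bar R) : 0 <= s -> 0 <= t -> lne (s * t) = lne s + lne t.
Proof.
move=> s0 t0; apply: expeR_inj.
by rewrite expeRD !lneK// in_itv/= ?s0 ?t0 ?mule_ge0// leey.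
Qed.

Lemma divM_EFin_ge0 (p q p' q' : R) : (0 <= q)%R -> (0 <= q')%R ->
  (p * p')%:E / (q * q')%:E = (p%:E / q%:E) * (p'%:E / q'%:E).
Proof.
move=> q0 q'0; rewrite muleACA -EFinM; congr (_ * _).
move: q0; rewrite le_eqVlt => /predU1P[<-|q0].
  rewrite mul0r inve0 gt0_mulye// inver; case: eqP => // /eqP ?.
  by rewrite lte_fin invr_gt0 lt_neqAle eq_sym q'0 andbT.
move: q'0; rewrite le_eqVlt => /predU1P[<-|q'0].
  by rewrite mulr0 inve0 gt0_muley// inver gt_eqF// lte_fin invr_gt0.
by rewrite !inver !gt_eqF ?mulr_gt0// -EFinM invfM.
Qed.

Lemma divE_ge0 (p q : R) : (0 <= p)%R -> (0 <= q)%R -> 0 <= p%:E / q%:E.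
Proof. by move=> p0 q0; rewrite mule_ge0// inve_ge0. Qed.

Lemma lne_divM (p q p' q' : R) :
  (0 <= p)%R -> (0 <= q)%R -> (0 <= p')%R -> (0 <= q')%R ->
  lne ((p * p')%:E / (q * q')%:E) = lne (p%:E / q%:E) + lne (p'%:E / q'%:E).
Proof. by move=> ? ? ? ?; rewrite divM_EFin_ge0// lneM_ge0// divE_ge0. Qed.

Lemma lne_div_leP (p q e : R) : (0 <= p)%R -> (0 <= q)%R ->
  (lne (p%:E / q%:E) <= e%:E) = (p <= expR e * q)%R.
Proof.
move=> p0 q0; rewrite -lee_expeR lneK; last by rewrite in_itv/= divE_ge0// leey.
move: q0; rewrite le_eqVlt => /predU1P[<-|q0]; last first.
  by rewrite inver gt_eqF// -EFinM lee_fin ler_pdivrMr.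
(* The quotient by 0 is [+oo] unless [p = 0], so a finite bound forces [p = 0]. *)
rewrite inve0 mulr0; move: p0; rewrite le_eqVlt => /predU1P[<-|p0].
  by rewrite mul0e lexx lee_fin expR_ge0.
by rewrite gt0_muley//= [RHS]leNgt p0.
Qed.

Lemma renyi_oo_leP (X : finType) (mu nu : X -> R) (e : R) :
  (forall x, 0 <= mu x)%R -> (forall x, 0 <= nu x)%R ->
  renyi_oo mu nu <= e%:E <-> (forall x, mu x <= expR e * nu x)%R.
Proof.
move=> mu0 nu0; split=> [h x|h].
  rewrite -lne_div_leP//; apply: le_trans h.
  by apply: ereal_sup_ubound; exists x.
by apply: ge_ereal_sup => _ [x _ <-]; rewrite lne_div_leP.
Qed.

(** A negative value would give [mu <= expR e * nu] pointwise with [e < 0]; summing yields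
    [1 <= expR e], a contradiction. *)
Lemma renyi_oo_ge0 (X : finType) (mu nu : X -> R) :
  distr mu -> distr nu -> 0 <= renyi_oo mu nu.
Proof.
move=> [mu0 mu1] [nu0 nu1]; rewrite leNgt; apply/negP => lt0.
have [e e0 /renyi_oo_leP h] : exists2 e : R, (e < 0)%R & renyi_oo mu nu <= e%:E.
  case: (renyi_oo mu nu) lt0 => [r|//|_]; first by exists r.
  by exists (-1)%R; rewrite ?leNye// ltrN10.
have : (1 <= expR e * 1)%R.
  by rewrite -{1}mu1 -nu1 mulr_sumr ler_sum// => x _; exact: h.
by rewrite mulr1 leNgt expR_lt1 e0.
Qed.

Lemma renyi_oo_refl (X : finType) (mu : X -> R) :
  distr mu -> renyi_oo mu mu <= 0.
Proof. by move=> [mu0 mu1]; apply/renyi_oo_leP => // x; rewrite expR0 mul1r. Qed.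

(** Pointwise domination passes through composition, the factors [expR e] and [expR d] being
    multiplied; infinite bounds are trivial. *)
Lemma renyi_oo_comp (X Y : finType) (mu nu : X -> R) (B B' : X -> Y -> R) eps del :
  distr mu -> distr nu -> (forall x, distr (B x)) -> (forall x, distr (B' x)) ->
  0 <= eps -> 0 <= del ->
  renyi_oo mu nu <= eps -> (forall x, renyi_oo (B x) (B' x) <= del) ->
  renyi_oo (fun y => \sum_x B x y * mu x)%R (fun y => \sum_x B' x y * nu x)%R
    <= eps + del.
Proof.
move=> dmu dnu dB dB'.
case: eps => [e| |]//; last by move=> _; case: del => // *; rewrite leey.
case: del => [d| |]//; last by move=> *; rewrite leey.
move=> _ _ /renyi_oo_leP; have [[mu0 _] [nu0 _]] := (dmu, dnu).
move=> /(_ mu0 nu0) he hd; apply/renyi_oo_leP => [y|y|y].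
- by have [] := distr_comp dmu dB.
- by have [] := distr_comp dnu dB'.
rewrite mulr_sumr ler_sum// => x _; have [B0 _] := dB x; have [B'0 _] := dB' x.
have /renyi_oo_leP := hd x => /(_ B0 B'0 y) h.
by rewrite [leLHS]mulrC expRD [(B' x y * _)%R]mulrC mulrACA ler_pM.
Qed.

Lemma renyi_oo_chain_le n m (p q : R) (f g : 'I_n -> R) (f' g' : 'I_m -> R) eps del :
  (0 <= p <= 1)%R -> (0 <= q <= 1)%R ->
  distr f -> distr g -> distr f' -> distr g' ->
  renyi_oo f g <= eps -> renyi_oo f' g' <= del ->
  renyi_oo (mixture p f f') (mixture q g g') <= chain_bound +oo p q eps del.
Proof.
move=> /andP[p0 p1] /andP[q0 q1] [f0 _] [g0 _] [f'0 _] [g'0 _] fg fg'.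
apply: ge_ereal_sup => _ [x _ <-]; rewrite /= le_max.
case: (split_ordP x) => i ->; rewrite ?mixturel ?mixturer lne_divM ?subr_ge0//.
  apply/orP; left; rewrite leeD2l//; apply: le_trans fg.
  by apply: ereal_sup_ubound; exists i.
apply/orP; right; rewrite leeD2l//; apply: le_trans fg'.
by apply: ereal_sup_ubound; exists i.
Qed.

(** The carrier of a distribution is inhabited, so the finite supremum is a maximum. The chain rule
    can then be checked at single outcomes. *)
Lemma renyi_oo_attained (X : finType) (mu nu : X -> R) : distr mu ->
  exists x, renyi_oo mu nu = lne ((mu x)%:E / (nu x)%:E).
Proof.
move=> [mu0 mu1].
have [x0 _] : exists x, (0 < mu x)%R.
  apply/existsP; apply: contraT; rewrite negb_exists => /forallP h.
  suff : (1 <= 0 :> R)%R by rewrite leNgt ltr01.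
  by rewrite -[leLHS]mu1 sumr_le0// => i _; rewrite leNgt h.
case: (@Order.TotalTheory.arg_maxP _ _ _ x0 xpredT
  (fun x => lne ((mu x)%:E / (nu x)%:E)) isT) => x _ hx.
exists x; apply/eqP; rewrite eq_le; apply/andP; split.
  by apply: ge_ereal_sup => _ [y _ <-]; exact: hx.
by apply: ereal_sup_ubound; exists x.
Qed.

Lemma renyi_oo_chain_ge n m (p q : R) (f g : 'I_n -> R) (f' g' : 'I_m -> R) :
  (0 <= p <= 1)%R -> (0 <= q <= 1)%R ->
  distr f -> distr g -> distr f' -> distr g' ->
  chain_bound +oo p q (renyi_oo f g) (renyi_oo f' g') <=
  renyi_oo (mixture p f f') (mixture q g g').
Proof.
move=> /andP[p0 p1] /andP[q0 q1] df dg df' dg'.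
have [i ei] := renyi_oo_attained g df; have [j ej] := renyi_oo_attained g' df'.
have [[f0 _] [g0 _] [f'0 _] [g'0 _]] := And4 df dg df' dg'.
rewrite /chain_bound ei ej ge_max -!lne_divM ?subr_ge0//.
apply/andP; split; apply: ereal_sup_ubound.
  by exists (lshift m i) => //=; rewrite !mixturel.
by exists (rshift n j) => //=; rewrite !mixturer.
Qed.

End InfiniteOrder.

(** * Soundness and completeness *)

Section Renyi.
Variables (R : realType) (alpha : \bar R).
Hypotheses (alpha_ge0 : 0 <= alpha) (alpha_neq1 : alpha <> 1).

Lemma finite_order a : alpha = a%:E -> (0 <= a)%R /\ a != 1%R.
Proof.
move=> E; split; first by rewrite -lee_fin -E.
by apply/eqP => a1; apply: alpha_neq1; rewrite E a1.
Qed.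

Lemma renyi_ge0 (X : finType) (mu nu : X -> R) :
  distr mu -> distr nu -> 0 <= renyi alpha mu nu.
Proof.
case: alpha alpha_ge0 finite_order => [a _ /(_ _ erefl)[a0 a1]|_ _|//].
  exact: renyi_fin_ge0.
exact: renyi_oo_ge0.
Qed.

Lemma renyi_refl (X : finType) (mu : X -> R) : distr mu -> renyi alpha mu mu <= 0.
Proof.
case: alpha alpha_ge0 finite_order => [a _ /(_ _ erefl)[a0 a1]|_ _|//].
  exact: renyi_fin_refl.
exact: renyi_oo_refl.
Qed.

Lemma renyi_comp (X Y : finType) (mu nu : X -> R) (B B' : X -> Y -> R) eps del :
  distr mu -> distr nu -> (forall x, distr (B x)) -> (forall x, distr (B' x)) ->
  0 <= eps -> 0 <= del ->
  renyi alpha mu nu <= eps -> (forall x, renyi alpha (B x) (B' x) <= del) ->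
  renyi alpha (fun y => \sum_x B x y * mu x)%R (fun y => \sum_x B' x y * nu x)%R
    <= eps + del.
Proof.
case: alpha alpha_ge0 finite_order => [a _ /(_ _ erefl)[a0 a1]|_ _|//].
  exact: renyi_fin_comp.
exact: renyi_oo_comp.
Qed.

Lemma renyi_chain_le n m (p q : R) (f g : 'I_n -> R) (f' g' : 'I_m -> R) eps del :
  (0 <= p <= 1)%R -> (0 <= q <= 1)%R ->
  distr f -> distr g -> distr f' -> distr g' ->
  renyi alpha f g <= eps -> renyi alpha f' g' <= del ->
  renyi alpha (mixture p f f') (mixture q g g') <= chain_bound alpha p q eps del.
Proof.
case: alpha alpha_ge0 finite_order => [a _ /(_ _ erefl)[a0 a1]|_ _|//].
  exact: renyi_fin_chain_le.
exact: renyi_oo_chain_le.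
Qed.

Lemma renyi_chain_ge n m (p q : R) (f g : 'I_n -> R) (f' g' : 'I_m -> R) :
  (0 <= p <= 1)%R -> (0 <= q <= 1)%R ->
  distr f -> distr g -> distr f' -> distr g' ->
  chain_bound alpha p q (renyi alpha f g) (renyi alpha f' g') <=
  renyi alpha (mixture p f f') (mixture q g g').
Proof.
case: alpha alpha_ge0 finite_order => [a _ /(_ _ erefl)[a0 a1]|_ _|//].
  exact: renyi_fin_chain_ge.
exact: renyi_oo_chain_ge.
Qed.

(** Data processing: a common kernel diverges from itself by at most 0, so composing with it adds
    nothing. *)
Lemma renyi_pushforward (X Y : finType) (mu nu : X -> R) (B : X -> Y -> R) :
  distr mu -> distr nu -> (forall x, distr (B x)) ->
  renyi alpha (fun y => \sum_x B x y * mu x)%R (fun y => \sum_x B x y * nu x)%R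
    <= renyi alpha mu nu.
Proof.
move=> dmu dnu dB; rewrite -[leRHS]adde0.
by apply: renyi_comp => // [|x]; [exact: renyi_ge0|exact: renyi_refl].
Qed.

(** * Divergence of stochastic matrices under composition and direct sum *)

Lemma stoch_distr n m (A : stoch R n m) j : distr (fun i => stoch_mx A i j).
Proof. by have /column_stochasticP[A1 A0] := stochP A; split. Qed.

Lemma stoch_gt0 n m (A : stoch R n.+1 m) : (0 < m)%N.
Proof.
case: m A => // A; have [_] := stoch_distr A ord0.
by rewrite big_ord0 => /esym/eqP; rewrite oner_eq0.
Qed.

(** For [n = 0] the maximum is 0 by convention, whence [0 <= eps]; for [n > 0] also [m > 0], as an
    empty column cannot sum to 1. *)
Lemma renyi_max_leP n m (A B : stoch R n m) eps : 0 <= eps ->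
  renyi_max alpha A B <= eps <->
  forall j, renyi alpha (fun i => stoch_mx A i j) (fun i => stoch_mx B i j) <= eps.
Proof.
move=> eps0; rewrite /renyi_max.
case: n A B => [|n] A B; first by split=> // _ [].
rewrite (gtn_eqF (stoch_gt0 A))/=.
split=> [/bigmax_leP[_ h] j|h]; first exact: h.
by apply/bigmax_leP; rewrite leNye; split=> // j _; exact: h.
Qed.

Lemma renyi_max_ge0 n m (A B : stoch R n m) : 0 <= renyi_max alpha A B.
Proof.
rewrite /renyi_max; case: n A B => [|n] A B //.
rewrite (gtn_eqF (stoch_gt0 A))/=.
by apply: le_trans (le_bigmax _ _ ord0); apply: renyi_ge0; exact: stoch_distr.
Qed.

Lemma renyi_le_max n m (A B : stoch R n m) j :
  renyi alpha (fun i => stoch_mx A i j) (fun i => stoch_mx B i j)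
    <= renyi_max alpha A B.
Proof.
have /renyi_max_leP := lexx (renyi_max alpha A B).
by apply; exact: renyi_max_ge0.
Qed.

Lemma renyi_max_comp n m k (A A' : stoch R n m) (B B' : stoch R m k) :
  renyi_max alpha (stoch_mx B *m stoch_mx A) (stoch_mx B' *m stoch_mx A')
    <= renyi_max alpha A A' + renyi_max alpha B B'.
Proof.
(* The products are repackaged as stochastic matrices, to which [renyi_max_leP] applies. *)
pose C := smc_comp (A : smc_hom (fstoch_ops R) n m) B.
pose C' := smc_comp (A' : smc_hom (fstoch_ops R) n m) B'.
apply/(@renyi_max_leP _ _ C C'); first by rewrite adde_ge0// renyi_max_ge0.
move=> j; rewrite /=.
under eq_fun do rewrite mxE; under [X in renyi _ _ X]eq_fun do rewrite mxE.
apply: renyi_comp; rewrite ?renyi_max_ge0// => *;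
  by [exact: stoch_distr|exact: renyi_le_max].
Qed.

Lemma distr_dirac (Y : finType) (y0 : Y) : distr (fun y => (y == y0)%:R : R).
Proof.
split=> [y|]; first exact: ler0n.
by rewrite (bigD1 y0)//= eqxx big1 ?addr0// => y /negbTE ->.
Qed.

(** Presents a column padded with zeros as the image of a column of [A] under Dirac kernels, the
    form expected by [renyi_pushforward]. *)
Lemma block_mx_lshift n m n' m' (A : 'M[R]_(m, n)) (B : 'M[R]_(m', n')) i k :
  (block_mx A 0 0 B i (lshift n' k) = \sum_x (i == lshift m' x)%:R * A x k)%R.
Proof.
case: (split_ordP i) => l ->.
  rewrite block_mxEul (bigD1 l)//= eqxx mul1r big1 ?addr0// => x xl.
  by rewrite eq_lshift eq_sym (negbTE xl) mul0r.
by rewrite block_mxEdl mxE big1// => x _; rewrite eq_rlshift mul0r.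
Qed.

Lemma block_mx_rshift n m n' m' (A : 'M[R]_(m, n)) (B : 'M[R]_(m', n')) i k :
  (block_mx A 0 0 B i (rshift n k) = \sum_x (i == rshift m x)%:R * B x k)%R.
Proof.
case: (split_ordP i) => l ->; last first.
  rewrite block_mxEdr (bigD1 l)//= eqxx mul1r big1 ?addr0// => x xl.
  by rewrite eq_rshift eq_sym (negbTE xl) mul0r.
by rewrite block_mxEur mxE big1// => x _; rewrite eq_lrshift mul0r.
Qed.

Lemma renyi_max_tens n m n' m' (A A' : stoch R n m) (B B' : stoch R n' m') :
  renyi_max alpha (block_mx (stoch_mx A) 0 0 (stoch_mx B))
                  (block_mx (stoch_mx A') 0 0 (stoch_mx B'))
    <= maxe (renyi_max alpha A A') (renyi_max alpha B B').
Proof.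
pose C := smc_tens (A : smc_hom (fstoch_ops R) n m) (B : smc_hom (fstoch_ops R) n' m').
pose C' := smc_tens (A' : smc_hom (fstoch_ops R) n m)
  (B' : smc_hom (fstoch_ops R) n' m').
apply/(@renyi_max_leP _ _ C C'); first by rewrite le_max renyi_max_ge0.
move=> j; case: (split_ordP j) => k -> /=; rewrite le_max; apply/orP.
  left; under eq_fun do rewrite block_mx_lshift.
  under [X in renyi _ _ X]eq_fun do rewrite block_mx_lshift.
  apply: le_trans (renyi_le_max _ _ k).
  by apply: renyi_pushforward => [||x]; [exact: stoch_distr..|exact: distr_dirac].
right; under eq_fun do rewrite block_mx_rshift.
under [X in renyi _ _ X]eq_fun do rewrite block_mx_rshift.
apply: le_trans (renyi_le_max _ _ k).
by apply: renyi_pushforward => [||x]; [exact: stoch_distr..|exact: distr_dirac].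
Qed.

(** * Soundness of derivations *)

Variable TCA : equations R.
Hypothesis TCA_Fritz : axiomatises_FStoch TCA.
Local Notation T := (renyi_theory TCA alpha).

Lemma interp_hcast n m n' m' (en : n = n') (em : m = m') (f : term R n m) :
  interp (hcast en em f) = hcast en em (interp f).
Proof. by case: n' / en; case: m' / em. Qed.

Lemma interp_law n m (f g : term R n m) :
  @ssmc_law (term_ops R) n m f g -> interp f = interp g.
Proof.
case=> {n m f g}; intros; apply: fstoch_lawP;
  rewrite /= ?interp_hcast /= ?interp_hcast.
- exact: (@law_compA (fstoch_ops R)).
- exact: (@law_idl (fstoch_ops R)).
- exact: (@law_idr (fstoch_ops R)).
- exact: (@law_tens_id (fstoch_ops R)).
- exact: (@law_interchange (fstoch_ops R)).
- exact: (@law_tensA (fstoch_ops R)).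
- exact: (@law_tens0l (fstoch_ops R)).
- exact: (@law_tens0r (fstoch_ops R)).
- exact: (@law_symm_nat (fstoch_ops R)).
- exact: (@law_symmK (fstoch_ops R)).
- exact: (@law_symm0 (fstoch_ops R)).
- exact: (@law_hexagon (fstoch_ops R)).
Qed.

Lemma choice_mixture n m (p : {i01 R}) (f : term R 1 n) (f' : term R 1 m) :
  (fun i => stoch_mx (interp (t_comp (t_c p) (t_tens f f'))) i ord0) =
  mixture p%:num (fun i => stoch_mx (interp f) i ord0)
                 (fun i => stoch_mx (interp f') i ord0).
Proof.
apply/funext => i /=; rewrite mxE.
rewrite (@big_split_ord _ _ _ 1 1)/= !big_ord1.
case: (split_ordP i) => k ->; rewrite ?mixturel ?mixturer.
  by rewrite (@block_mxEul _ n m 1 1) (@block_mxEur _ n m 1 1) !mxE/= mul0r addr0 mulrC.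
by rewrite (@block_mxEdl _ n m 1 1) (@block_mxEdr _ n m 1 1) !mxE/= mul0r add0r mulrC.
Qed.

Definition valid (j : judgment R) :=
  match j with
  | JEq _ _ f g => interp f = interp g
  | JQeq _ _ eps f g => renyi_max alpha (interp f) (interp g) <= eps
  end.

Lemma soundness j : der T j -> valid j.
Proof.
elim=> {j} /=.
- move=> G j [] {G j}.
  + by move=> n m f g fg _ _; apply/TCA_Fritz/mc_ax.
  + move=> n m f _ _ /=; apply/renyi_max_leP => // j.
    by apply: renyi_refl; exact: stoch_distr.
  + move=> n m f g f' g' p q eps del eps0 del0 _ IH.
    have /renyi_max_leP fg : valid (JQeq eps f g) by apply: IH; left.
    have /renyi_max_leP fg' : valid (JQeq del f' g') by apply: IH; right.
    rewrite /valid.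
    have bnd : renyi alpha
        (fun i => stoch_mx (interp (t_comp (t_c p) (t_tens f f'))) i ord0)
        (fun i => stoch_mx (interp (t_comp (t_c q) (t_tens g g'))) i ord0)
        <= chain_bound alpha p%:num q%:num eps del.
      rewrite !choice_mixture; apply: renyi_chain_le; rewrite ?ge0 ?le1//;
        by [exact: stoch_distr|exact: fg|exact: fg'].
    (* The chain bound is nonnegative because it dominates a divergence. *)
    apply/renyi_max_leP => [|j]; last by rewrite (ord1 j).
    by apply: le_trans bnd; apply: renyi_ge0; exact: stoch_distr.
  + move=> n m n' m' f g f' g' eps del eps0 del0 _ IH.
    have fg : valid (JQeq eps f g) by apply: IH; left.
    have fg' : valid (JQeq del f' g') by apply: IH; right.
    apply: le_trans (renyi_max_tens _ _ _ _) _.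
    by rewrite ge_max !le_max fg fg' orbT.
- by move=> n m f g; exact: interp_law.
- by [].
- by [].
- by move=> n m f g h _ -> _ ->.
- by move=> n m k f f' g g' _ -> _ ->.
- by move=> n m n' m' f f' g g' _ -> _ ->.
- by move=> n m f f' g eps _ ->.
- by move=> n m f g g' eps _ ->.
- by move=> n m f g eps eps' ee' _ /le_trans; apply.
- move=> n m f g I eps _ IH; apply: le_ereal_inf_tmp => _ [i _ <-]; exact: IH.
- move=> n m k f f' g g' eps del _ fe _ gd.
  by apply: le_trans (renyi_max_comp _ _ _ _) _; exact: leeD.
- move=> n m n' m' f f' g g' eps del _ fe _ gd.
  apply: le_trans (renyi_max_tens _ _ _ _) _; apply: le_trans (leeD fe gd).
  (* The maximum of two nonnegative distances is at most their sum. *)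
  by rewrite ge_max leeDl ?leeDr// renyi_max_ge0.
Qed.

(** * Completeness: derivation of the exact distances *)

Lemma der_interp n m (f g : term R n m) : interp f = interp g -> der T (JEq f g).
Proof.
move=> /TCA_Fritz; elim=> {n m f g}.
- by move=> n m f g fg; apply: (d_ax (rt_CA alpha fg)).
- by move=> n m f g; exact: d_law.
- by move=> n m f; exact: d_refl.
- by move=> n m f g _; exact: d_sym.
- by move=> n m f g h _ fg _; exact: d_trans.
- by move=> n m k f f' g g' _ ff' _; exact: d_comp.
- by move=> n m n' m' f f' g g' _ ff' _; exact: d_tens.
Qed.

Lemma der_qrefl n m (f : term R n m) eps : 0 <= eps -> der T (JQeq eps f f).
Proof. by move=> /d_mono; apply; apply: (d_ax (rt_zero _ _ f)). Qed.

(** One pair of representing terms suffices, as terms with equal interpretation are provably equal.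
    The existential also supplies surjectivity of the interpretation. *)
Definition derivable_at n m (A B : stoch R n m) eps :=
  exists f g : term R n m,
    [/\ interp f = A, interp g = B & der T (JQeq eps f g)].

Lemma derivable_at_der n m (f g : term R n m) eps :
  derivable_at (interp f) (interp g) eps -> der T (JQeq eps f g).
Proof.
move=> [f' [g' [ef eg fg]]].
exact: (d_repl_l (der_interp ef) (d_repl_r (der_interp eg) fg)).
Qed.

Lemma column_mixture m (A : stoch R 1 m.+2) :
  exists (p : {i01 R}) (A' : stoch R 1 m.+1),
    (fun i => stoch_mx A i ord0) =
    @mixture R 1 m.+1 p%:num (fun=> 1%R) (fun i => stoch_mx A' i ord0).
Proof.
have [A0 A1] := stoch_distr A ord0.
set p := stoch_mx A ord0 ord0; rewrite big_ord_recl -/p in A1.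
set s := (\sum_i _)%R in A1.
have p0 : (0 <= p)%R by exact: A0.
have s0 : (0 <= s)%R by apply: sumr_ge0.
have p1 : (p <= 1)%R by rewrite -A1 lerDl.
have p01 : Itv.spec (@Itv.num_sem R) (Itv.Real `[0%Z, 1%Z]) p.
  by apply/and3P; rewrite /= num_real !bnd_simp p0 p1.
(* The remaining outcomes are renormalised by their mass [s]. If [s = 0] their weight [1 - p]
   vanishes and any distribution serves; a Dirac one is taken. *)
pose a := if s == 0%R then (fun i : 'I_m.+1 => (i == ord0)%:R : R)
          else (fun i => stoch_mx A (lift ord0 i) ord0 / s)%R.
have [a0 a1] : distr a.
  rewrite /a; case: eqP => [_|/eqP s_neq0]; first exact: distr_dirac.
  split=> [i|]; first by rewrite divr_ge0.
  by rewrite -mulr_suml mulfV.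
have csA' : column_stochastic (\col_i a i).
  apply/column_stochasticP; split=> [j|i j]; last by rewrite mxE.
  by rewrite -[RHS]a1; apply: eq_bigr => i _; rewrite mxE.
exists (Itv.mk p01), (Stoch csA').
apply/funext => i; case: (@split_ordP 1 m.+1 i) => k ->.
  by rewrite mixturel mulr1 (ord1 k)/=; congr (stoch_mx A _ _); apply: val_inj.
rewrite mixturer /= mxE.
have -> : rshift 1 k = lift ord0 k by apply: val_inj.
have -> : (1 - p = s)%R by rewrite -A1 addrAC subrr add0r.
rewrite /a; case: eqP => [se0|/eqP s_neq0]; last by rewrite mulrC divfK.
rewrite se0 mul0r; have /psumr_eq0P : s = 0%R by [].
by apply.
Qed.

Lemma column_complete m (A B : stoch R 1 m.+1) :
  derivable_at A B
    (renyi alpha (fun i => stoch_mx A i ord0) (fun i => stoch_mx B i ord0)).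
Proof.
have colP k (C D : stoch R 1 k) :
    (fun i => stoch_mx C i ord0) = (fun i => stoch_mx D i ord0) -> C = D.
  move=> CD; apply: val_inj; apply/matrixP => i j; rewrite (ord1 j).
  exact: (congr1 (@^~ i) CD).
elim: m A B => [|m IH] A B.
  have E (C : stoch R 1 1) : interp (t_id 1) = C.
    apply: colP; apply/funext => i; have [_] := stoch_distr C ord0.
    by rewrite (ord1 i) big_ord1 /= mxE eqxx => ->.
  exists (t_id 1), (t_id 1); split=> //; apply: der_qrefl.
  by apply: renyi_ge0; exact: stoch_distr.
have [p [A' eA]] := column_mixture A; have [q [B' eB]] := column_mixture B.
have [f [g [ef eg fg]]] := IH A' B'.
have one (i : 'I_1) : stoch_mx (interp (t_id 1)) i ord0 = 1%R :> R.
  by rewrite (ord1 i) mxE eqxx.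
have E : (fun i => stoch_mx (interp (t_id 1)) i ord0) = (fun=> 1%R) :> ('I_1 -> R).
  by apply/funext => i; exact: one.
have d1 : distr (fun _ : 'I_1 => 1%R : R) by rewrite -E; exact: stoch_distr.
exists (t_comp (t_c p) (t_tens (t_id 1) f)), (t_comp (t_c q) (t_tens (t_id 1) g)).
split.
- by apply: colP; have := choice_mixture p (t_id 1) f; rewrite E ef -eA => h; exact: h.
- by apply: colP; have := choice_mixture q (t_id 1) g; rewrite E eg -eB => h; exact: h.
(* Chain yields the bound [chain_bound] at the divergences of the branches, which by
   [renyi_chain_ge] is at most the divergence of the mixtures. *)
rewrite eA eB; apply: d_mono.
  by apply: (renyi_chain_ge _ _ d1 d1 (stoch_distr A' _) (stoch_distr B' _));
    rewrite ge0 le1.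
have e0 : 0 <= renyi alpha (fun _ : 'I_1 => 1%R : R) (fun=> 1%R) by exact: renyi_ge0.
have d0 : 0 <= renyi alpha (fun i => stoch_mx A' i ord0) (fun i => stoch_mx B' i ord0).
  by apply: renyi_ge0; exact: stoch_distr.
apply: (d_ax (rt_chain TCA alpha (t_id 1) (t_id 1) f g p q e0 d0)) => j [->|->//].
exact: der_qrefl.
Qed.

(** With [phi] acting on naturals, identities between structural matrices become index arithmetic
    free of casts. *)
Definition is_fun_mx m n (A : 'M[R]_(m, n)) (phi : nat -> nat) :=
  forall i j, A i j = (i == phi j :> nat)%:R.

Lemma is_fun_mxM n m k (A : 'M[R]_(m, n)) (B : 'M[R]_(k, m)) phi psi :
  (forall j, j < n -> phi j < m)%N ->
  is_fun_mx A phi -> is_fun_mx B psi -> is_fun_mx (B *m A) (psi \o phi).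
Proof.
move=> phi_lt hA hB i j; have lt := phi_lt _ (ltn_ord j).
rewrite mxE (bigD1 (Ordinal lt))//= big1 => [|l ne].
  by rewrite addr0 hA hB/= eqxx mulr1.
by rewrite hA -(inj_eq val_inj)/= in ne *; rewrite (negbTE ne) mulr0.
Qed.

Lemma is_fun_mx_block n m n' m' (A : 'M[R]_(m, n)) (B : 'M[R]_(m', n')) phi psi :
  (forall j, j < n -> phi j < m)%N ->
  is_fun_mx A phi -> is_fun_mx B psi ->
  is_fun_mx (block_mx A 0 0 B)
    (fun j => if (j < n)%N then phi j else (m + psi (j - n))%N).
Proof.
move=> phi_lt hA hB i j; case: (split_ordP j) => j' ->.
  rewrite block_mx_lshift/= (bigD1 (Ordinal (phi_lt _ (ltn_ord j'))))//=.
  rewrite hA/= eqxx mulr1 -(inj_eq val_inj)/= big1 ?addr0// => x.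
  by rewrite hA -(inj_eq val_inj)/= => /negbTE ->; rewrite mulr0.
rewrite block_mx_rshift/= addKn.
case: (split_ordP i) => l -> /=.
  rewrite big1 => [|x _]; last by rewrite eq_lrshift mul0r.
  rewrite (_ : (l == _ :> nat) = false)//; apply/negbTE/eqP.
  by have := ltn_ord l; lia.
rewrite (bigD1 l)//= eqxx mul1r big1 ?addr0 => [|x xl].
  by rewrite hB eqn_add2l.
by rewrite eq_rshift eq_sym (negbTE xl) mul0r.
Qed.

(* Up to conversion, (1 + m) + (1 + m) is 1 + (m + (1 + m)) and
   1 + ((1 + m) + m) is 2 + (m + m). *)
Fixpoint t_codiag m : term R (m + m) m :=
  match m with
  | 0 => t_id 0
  | k.+1 => t_comp (t_tens (t_id 1) (t_symm k k.+1)
                   : term R (k.+1 + k.+1) (2 + (k + k)))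
                   (t_tens (t_gen (@g_mu R)) (t_codiag k))
  end.

(** Every factor is the matrix of a function on indices, so it suffices to see that the composite
    function folds the second copy of [m] onto the first. *)
Lemma interp_codiag m : stoch_mx (interp (t_codiag m)) = row_mx 1%:M 1%:M.
Proof.
suff h : is_fun_mx (stoch_mx (interp (t_codiag m)))
    (fun j => if (j < m)%N then j else (j - m)%N).
  apply/matrixP => i j; rewrite h; case: (split_ordP j) => k ->.
    by rewrite row_mxEl mxE/=.
  by rewrite row_mxEr mxE/= addKn.
elim: m => [|m IH]; first by case.
have symm : is_fun_mx (stoch_mx (interp (t_symm m m.+1)))
    (fun j => if (j < m)%N then (m.+1 + j)%N else (j - m)%N).
  move=> i j /=; case: (split_ordP j) => j' ->; case: (split_ordP i) => i' ->;
  rewrite ?block_mxEul ?block_mxEur ?block_mxEdl ?block_mxEdr !mxE /=;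
  rewrite ?ltn_ord ?eqn_add2l ?ltnNge ?leq_addr ?addKn //=.
    by rewrite (_ : _ == _ = false)//; apply/negbTE/eqP; have := ltn_ord i'; lia.
  by rewrite (_ : _ == _ = false)//; apply/negbTE/eqP; have := ltn_ord j'; lia.
have mu : is_fun_mx (stoch_mx (interp (t_gen (@g_mu R)))) (fun=> 0%N).
  by move=> i j; rewrite /= mxE (ord1 i).
have id1 : is_fun_mx (stoch_mx (interp (t_id 1))) id by move=> i j; rewrite mxE.
have s1 := is_fun_mx_block (fun j h => h) id1 symm.
have s2 := @is_fun_mx_block 2 1 _ _ _ _ (fun=> 0%N) _ (fun _ _ => isT) mu IH.
move=> i j; rewrite [LHS](is_fun_mxM _ s1 s2); last first.
  by move=> {i j} j /=; repeat case: ifP; lia.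
congr (_ %:R); congr (nat_of_bool (_ == _)).
move: (nat_of_ord j) (ltn_ord j) => {}j /= j_lt.
by case: (ltnP j 1) => ?; case: (ltnP (j - 1) m) => ?;
  repeat match goal with |- context [if ?b then _ else _] => case: (boolP b) => ? end;
  lia.
Qed.

Fixpoint t_initial m : term R 0 m :=
  match m with
  | 0 => t_id 0
  | k.+1 => t_tens (t_gen (@g_eta R)) (t_initial k)
  end.

(** Induction on the number of columns: the first comes from [column_complete], the others from the
    induction hypothesis, and the codiagonal glues them. *)
Lemma matrix_complete n m (A B : stoch R n m) :
  derivable_at A B (renyi_max alpha A B).
Proof.
elim: n A B => [|n IH] A B.
  have E (C : stoch R 0 m) : interp (t_initial m) = C.
    by apply: val_inj; apply/matrixP => i [].
  exists (t_initial m), (t_initial m); split=> //.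
  by apply: der_qrefl; exact: renyi_max_ge0.
have decomp (C : stoch R n.+1 m) : exists (C1 : stoch R 1 m) (C' : stoch R n m),
    stoch_mx C = row_mx (stoch_mx C1) (stoch_mx C') :> 'M_(m, 1 + n).
  have /column_stochasticP[C1 C0] := stochP C.
  have cl : column_stochastic (lsubmx (stoch_mx C : 'M_(m, 1 + n))).
    apply/column_stochasticP; split=> [j|i j]; last by rewrite mxE.
    by rewrite -[RHS](C1 (lshift n j)); apply: eq_bigr => i _; rewrite mxE.
  have cr : column_stochastic (rsubmx (stoch_mx C : 'M_(m, 1 + n))).
    apply/column_stochasticP; split=> [j|i j]; last by rewrite mxE.
    by rewrite -[RHS](C1 (rshift 1 j)); apply: eq_bigr => i _; rewrite mxE.
  by exists (Stoch cl), (Stoch cr); rewrite /= hsubmxK.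
have [A1 [A' eA]] := decomp A; have [B1 [B' eB]] := decomp B.
have colE (C : stoch R n.+1 m) (C1 : stoch R 1 m) (C' : stoch R n m) :
    stoch_mx C = row_mx (stoch_mx C1) (stoch_mx C') :> 'M_(m, 1 + n) ->
    (forall i, stoch_mx C i ord0 = stoch_mx C1 i ord0) /\
    (forall i j, stoch_mx C i (lift ord0 j) = stoch_mx C' i j).
  move=> ->; split=> [i|i j].
    by rewrite -[RHS](row_mxEl _ (stoch_mx C')); congr (row_mx _ _ _ _); apply: val_inj.
  by rewrite -[RHS](row_mxEr (stoch_mx C1)); congr (row_mx _ _ _ _); apply: val_inj.
have [f1 [g1 [ef1 eg1 fg1]]] : derivable_at A1 B1
    (renyi alpha (fun i => stoch_mx A1 i ord0) (fun i => stoch_mx B1 i ord0)).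
  (* A stochastic column has at least one row, so [column_complete] applies. *)
  case: m A1 B1 {A B IH A' B' eA eB decomp colE} (stoch_gt0 A1) => // m A1 B1 _.
  exact: column_complete.
have [f [g [ef eg fg]]] := IH A' B'.
have E (C : stoch R n.+1 m) (C1 : stoch R 1 m) (C' : stoch R n m) h1 h :
    stoch_mx C = row_mx (stoch_mx C1) (stoch_mx C') :> 'M_(m, 1 + n) ->
    interp h1 = C1 -> interp h = C' ->
    interp (t_comp (t_tens h1 h) (t_codiag m) : term R n.+1 m) = C.
  move=> eC e1 e'; apply: val_inj => /=; rewrite eC interp_codiag e1 e'.
  by rewrite mul_row_block !mul1mx addr0 add0r.
exists (t_comp (t_tens f1 f) (t_codiag m)), (t_comp (t_tens g1 g) (t_codiag m)).
split; [exact: E eA ef1 ef|exact: E eB eg1 eg|].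
have [colA1 colA'] := colE _ _ _ eA; have [colB1 colB'] := colE _ _ _ eB.
set e1 := renyi _ _ _ in fg1.
have e1_ge0 : 0 <= e1 by apply: renyi_ge0; exact: stoch_distr.
have e_ge0 := renyi_max_ge0 A' B'.
(* Parmax gives the maximum; the summand 0 is the cost of composing with the same codiagonal on both
   sides. *)
apply: (d_mono (eps := maxe e1 (renyi_max alpha A' B') + 0)); last first.
  apply: d_nexp_comp; last exact: der_qrefl.
  by apply: (d_ax (rt_parmax TCA alpha f1 g1 f g e1_ge0 e_ge0)) => j [->|->].
rewrite adde0 ge_max; apply/andP; split.
  apply: le_trans (renyi_le_max A B ord0).
  under [in leRHS]eq_fun do rewrite colA1.
  by under [X in _ <= renyi _ _ X]eq_fun do rewrite colB1.
apply/renyi_max_leP => [|j]; first exact: renyi_max_ge0.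
apply: le_trans (renyi_le_max A B (lift ord0 j)).
under [in leRHS]eq_fun do rewrite colA'.
by under [X in _ <= renyi _ _ X]eq_fun do rewrite colB'.
Qed.

(** * The syntactic distance and the isomorphism *)

Lemma dist_renyi_max n m (f g : term R n m) :
  dist T f g = renyi_max alpha (stoch_mx (interp f)) (stoch_mx (interp g)).
Proof.
apply/eqP; rewrite eq_le; apply/andP; split.
  (* Completeness puts the divergence itself among the derivable bounds; soundness then makes it the
     least one. *)
  apply: ereal_inf_lbound; split; first exact: renyi_max_ge0.
  exact/derivable_at_der/matrix_complete.
by apply: le_ereal_inf_tmp => eps [_ /soundness].
Qed.

Definition syn_interp n m (x : smc_hom (Syn T) n m) : smc_hom (FStoch R) n m :=
  interp (syn_repr x).

Lemma syn_interpE n m (f : term R n m) : syn_interp (syn_class T f) = interp f.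
Proof. exact: (soundness (syn_classK _ f)). Qed.

Lemma syn_interp_bij n m : bijective (@syn_interp n m).
Proof.
(* Completeness for the pair [A], [A] already provides a term denoting [A]. *)
have surj (A : stoch R n m) : exists f : term R n m, interp f = A.
  by have [f [_ [fA _ _]]] := matrix_complete A A; exists f.
exists (fun A => syn_class T (projT1 (cid (surj A)))) => [x|A]; last first.
  by rewrite syn_interpE; case: cid.
rewrite -[RHS](syn_reprK x); apply/syn_classP/der_interp.
by case: cid.
Qed.

Lemma syn_interp_iso : @ssmc_iso (Syn T) (FStoch R) syn_interp.
Proof.
split=> *; rewrite ?syn_interpE//; exact: syn_interp_bij.
Qed.

End Renyi.

Theorem theorem5p7 (R : realType) (alpha : \bar R) (TCA : equations R)
    (alpha_ge0 : 0 <= alpha) (alpha_neq1 : alpha <> 1)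
    (TCA_Fritz : axiomatises_FStoch TCA) :
  exists F : forall n m : nat,
      smc_hom (Syn (renyi_theory TCA alpha)) n m -> smc_hom (FStoch R) n m,
    (forall (n m : nat) (f : term R n m),
        F n m (syn_class (renyi_theory TCA alpha) f) = interp f) /\
    ssmc_iso F /\
    (forall (n m : nat) (f g : term R n m),
        dist (renyi_theory TCA alpha) f g =
        renyi_max alpha (stoch_mx (interp f)) (stoch_mx (interp g))).
Proof.
exists (@syn_interp R alpha TCA); split; last split.
- exact: syn_interpE.
- exact: syn_interp_iso.
- exact: dist_renyi_max.
Qed.
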